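(* Let $\langle\mathcal{A}\,\|\,\mathcal{R}\rangle$ be a group presentation with finite alphabet $\mathcal{A}$ and Dehn $j$-functions $f_j(x)$, $j=0,1,2$. (a) Let $\langle\mathcal{A}\,\|\,\mathcal{R}'\rangle$ be obtained from $\langle\mathcal{A}\,\|\,\mathcal{R}\rangle$ by a $T$-transformation and let $f_j'(x)$, $j=0,1,2$, be the Dehn $j$-functions of $\langle\mathcal{A}\,\|\,\mathcal{R}'\rangle$. Then $f_0'(x)\preccurlyeq f_1(x)$, $f_1'(x)\simeq f_1(x)$, and $f_2'(x)\simeq f_2(x)$. (b) Let $\langle\mathcal{A}'\,\|\,\mathcal{R}'\rangle$ be obtained from $\langle\mathcal{A}\,\|\,\mathcal{R}\rangle$ by a stabilization and let $f_j'(x)$, $j=0,1,2$, be the Dehn $j$-functions of $\langle\mathcal{A}'\,\|\,\mathcal{R}'\rangle$. Then $f_j'(x)\simeq f_j(x)$ for $j=0,1,2$.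
   Context: Presentations. $\mathcal{A}=\{a_1,\dots,a_m\}$ is a finite alphabet, $\mathcal{A}^{\pm1}=\mathcal{A}\cup\mathcal{A}^{-1}$, $F(\mathcal{A})$ is the free group over $\mathcal{A}$, and $|W|$ is the length of a word $W$ over $\mathcal{A}^{\pm1}$. The relator set $\mathcal{R}$ (possibly infinite) of a presentation consists of nonempty cyclically reduced words over $\mathcal{A}^{\pm1}$; $\langle\langle\mathcal{R}\rangle\rangle$ is its normal closure in $F(\mathcal{A})$, and $\langle\mathcal{A}\,\|\,\mathcal{R}\rangle$ presents the group $F(\mathcal{A})/\langle\langle\mathcal{R}\rangle\rangle$. A word $W$ over $\mathcal{A}^{\pm1}$ is said to be in $\langle\langle\mathcal{R}\rangle\rangle$ if the element of $F(\mathcal{A})$ it represents is. Transformations. A $T$-transformation of $\langle\mathcal{A}\,\|\,\mathcal{R}\rangle$ is the replacement of a finite subset $\mathcal{S}$ of $\mathcal{R}$ by another finite set $\mathcal{U}$ of (nonempty) cyclically reduced words over $\mathcal{A}^{\pm1}$, provided this does not change the normal closure: $\mathcal{R}'=(\mathcal{R}\setminus\mathcal{S})\cup\mathcal{U}$ with $\langle\langle\mathcal{R}'\rangle\rangle=\langle\langle\mathcal{R}\rangle\rangle$. A stabilization is the operation of adding a (new) letter $b$ to both $\mathcal{A}$ and $\mathcal{R}$, or of deleting a letter $b$ from both $\mathcal{A}$ and $\mathcal{R}$; when deleting $b$, the letters $b^{\pm1}$ must not occur in any other word of $\mathcal{R}$. Van Kampen diagrams. $K(\mathcal{A},\mathcal{R})$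 is the standard presentation 2-complex: one 0-cell, oriented 1-cells in bijection with the letters of $\mathcal{A}^{\pm1}$ (a letter and its inverse corresponding to opposite orientations of one 1-cell), 2-cells in bijection with the words of $\mathcal{R}$, attached along these words. A van Kampen diagram over $\langle\mathcal{A}\,\|\,\mathcal{R}\rangle$ is a planar, finite, connected and simply connected 2-complex $\Delta$ with a continuous cellular map to $K(\mathcal{A},\mathcal{R})$ whose restriction to every (open) cell is a homeomorphism onto a cell. Thus each oriented edge $e$ carries a label $\varphi(e)\in\mathcal{A}^{\pm1}$ with $\varphi(e^{-1})=\varphi(e)^{-1}$, and the boundary of each 2-cell is labeled by a cyclic permutation of a word of $\mathcal{R}$ or its inverse. The label $\varphi(p)$ of a path $p=e_1\cdots e_k$ is $\varphi(e_1)\cdots\varphi(e_k)$. $\partial\Delta$ is the boundary path of $\Delta$, $\varphi(\partial\Delta)\equiv W$ means literal equality as cyclic words, and $|\Delta(j)|$ is the number of $j$-cells of $\Delta$. By van Kampen's lemma, $W\in\langle\langle\mathcal{R}\rangle\rangle$ if and only if there is a van Kampen diagram $\Delta$ with $\varphi(\partial\Delta)\equiv W$. Dehn $j$-functions. For $W\in\langle\langle\mathcal{R}\rangle\rangle$ and $j\in\{0,1,2\}$ let $L_j(W)=\min\{|\Delta(j)| : \varphi(\partial\Delta)\equiv W\}$, the minimum over van Kampen diagrams $\Delta$ over the presentation. The Dehn $j$-function is, for integers $x\ge1$, $f_j(x)=\max\{L_j(W) : W\in\langle\langle\mathcal{R}\rangle\rangle,\ |W|\le x\}$. Comparison of functions.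 For functions $f,g:\mathbb{N}\to\mathbb{N}\cup\{0\}$, where $\mathbb{N}=\{1,2,\dots\}$, write $f\preccurlyeq g$ if there is an integer $C>0$ such that $f(x)\le C\,g(Cx)+Cx$ for every $x\in\mathbb{N}$. Write $f\simeq g$ if $f\preccurlyeq g$ and $g\preccurlyeq f$. *)

(* Defs.v *)
From mathcomp Require Import all_boot finmap.
From mathcomp Require Import boolp classical_sets cardinality.

Set Implicit Arguments.
Unset Strict Implicit.
Unset Printing Implicit Defensive.

Local Open Scope classical_set_scope.

(* Letters are taken in an arbitrary ambient type L; an alphabet is a finite
   subset of L.  (a, true) stands for the letter a and (a, false) for a^-1. *)
Definition letter (L : choiceType) : Type := (L * bool)%type.
Definition word (L : choiceType) : Type := seq (L * bool).

Section Words.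
Variable L : choiceType.
Implicit Types (x y : letter L) (u v w : word L) (A : {fset L}).

Definition linv x : letter L := (x.1, ~~ x.2).
Definition winv w : word L := rev (map linv w).

Definition word_over A w : bool := all (fun x : L * bool => x.1 \in A) w.

Definition cyclically_reduced w : bool :=
  cycle (fun x y : L * bool => y != linv x) w.

Definition relator_word A w : Prop :=
  [/\ w <> [::], word_over A w & cyclically_reduced w].

(* Equality of the elements represented in the free group. *)
Inductive free_eq : word L -> word L -> Prop :=
| free_eq_refl w : free_eq w w
| free_eq_sym u v : free_eq u v -> free_eq v u
| free_eq_trans u v w : free_eq u v -> free_eq v w -> free_eq u w
| free_eq_cancel u x v : free_eq (u ++ x :: linv x :: v) (u ++ v).

End Words.

Record presentation (L : choiceType) := Presentation {
  alphabet : {fset L};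
  relators : set (word L);
  relatorsP : forall r, relators r -> relator_word alphabet r
}.

(* The normal closure of the relators in F(alphabet): a subset of the free
   group is encoded as the set of all words over the alphabet representing
   its elements. *)
Inductive normal_closure (L : choiceType) (P : presentation L) :
    word L -> Prop :=
| ncl_one : normal_closure P [::]
| ncl_relator r : relators P r -> normal_closure P r
| ncl_mul u v :
    normal_closure P u -> normal_closure P v -> normal_closure P (u ++ v)
| ncl_inv u : normal_closure P u -> normal_closure P (winv u)
| ncl_conj g u :
    word_over (alphabet P) g -> normal_closure P u ->
    normal_closure P (g ++ u ++ winv g)
| ncl_free_eq u v :
    word_over (alphabet P) v -> free_eq u v ->
    normal_closure P u -> normal_closure P v.

Section Transformations.
Variable L : choiceType.
Implicit Types P : presentation L.

Definition T_transformation P P' : Prop :=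
  exists S U : set (word L),
    [/\ finite_set S, S `<=` relators P,
        finite_set U & U `<=` relator_word (alphabet P)] /\
    [/\ alphabet P' = alphabet P,
        relators P' = (relators P `\` S) `|` U &
        forall w, normal_closure P' w <-> normal_closure P w].

Definition add_letter P P' : Prop :=
  exists b : L,
    [/\ b \notin alphabet P,
        alphabet P' = (b |` alphabet P)%fset &
        relators P' = relators P `|` [set [:: (b, true)]]].

Definition delete_letter P P' : Prop :=
  exists b : L,
    [/\ b \in alphabet P, relators P [:: (b, true)] &
        forall r, relators P r -> r <> [:: (b, true)] -> b \notin map fst r] /\
    [/\ alphabet P' = (alphabet P `\ b)%fset &
        relators P' = relators P `\` [set [:: (b, true)]]].

Definition stabilization P P' : Prop := add_letter P P' \/ delete_letter P P'.

End Transformations.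

(* A labelled finite 2-complex embedded in the plane, encoded as a map on the
   sphere: the plane is the sphere minus a point of the outer region, and the
   complex is the complement of that region.
   - A dart is an oriented edge d; einv d is the opposite oriented edge, so each
     edge is a pair of darts.
   - next d is the dart following d on the boundary of the region lying to the
     left of d, so that next \o einv is the rotation around the origin of a dart.
   - side d is the region to the left of d: a 2-cell, or None for the outer
     region.
   - The vertices are the orbits of the rotation (the one-vertex complex without
     edges included), and the regions are the orbits of next.
   Connected gluings of polygons of this kind are closed oriented surfaces.  As
   face does not count the outer region, diag_euler says that the surface has
   Euler characteristic 2, i.e. is a sphere; hence the complement of the open
   outer region is simply connected. *)
Record diagram (L : choiceType) := Diagram {
  vertex : finType;
  dart : finType;
  face : finType;
  org : dart -> vertex;
  einv : dart -> dart;
  next : dart -> dart;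
  side : dart -> option face;
  lab : dart -> letter L;
  einvK : involutive einv;
  einv_neq : forall d, einv d != d;
  next_inj : injective next;
  org_orbit : forall d e, org d = org e <-> fconnect (next \o einv) d e;
  side_orbit : forall d e, side d = side e <-> fconnect next d e;
  side_onto : forall f, exists d, side d = Some f;
  side_outer : dart -> exists d, side d = None;
  lab_einv : forall d, lab (einv d) = linv (lab d);
  diag_connected : forall u v : vertex,
    connect (fun s t => [exists d, (org d == s) && (org (einv d) == t)]) u v;
  diag_euler : #|vertex| + #|face| = #|dart|./2 + 1
}.

Section VanKampen.
Variable L : choiceType.
Implicit Types (P : presentation L) (D : diagram L) (W : word L).

Definition cyclic_perm (u v : word L) : Prop := exists i, u = rot i v.

(* The cellular map to the presentation complex exists if and only if each
   edge is labelled by a letter and each 2-cell boundary reads a relator or its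
   inverse, up to the starting point. *)
Definition diagram_over P D : Prop :=
  (forall d : dart D, (lab d).1 \in alphabet P) /\
  (forall (d : dart D) (f : face D), side d = Some f ->
     exists2 r, relators P r &
       cyclic_perm (map (@lab L D) (orbit (@next L D) d)) r \/
       cyclic_perm (map (@lab L D) (orbit (@next L D) d)) (winv r)).

(* p goes exactly once around the outer region, from an arbitrary starting
   point; it is empty exactly for the one-vertex diagram. *)
Definition boundary_path D (p : seq (dart D)) : Prop :=
  [/\ uniq p, fcycle (@next L D) p &
      forall d, (d \in p) = (side d == None)].

(* This traverses the boundary with the outer region to its left; the mirror
   image of a diagram exchanges the two orientations of the boundary. *)
Definition boundary_label D W : Prop :=
  exists2 p, boundary_path (D := D) p & cyclic_perm (map (@lab L D) p) W.

Definition num_cells (j : nat) D : nat :=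
  match j with
  | 0 => #|vertex D|
  | 1 => #|dart D|./2
  | _ => #|face D|
  end.

End VanKampen.

(* Both are 0 by convention when there is no such element. *)
Definition nat_min (A : set nat) : nat :=
  xget 0 [set n | A n /\ forall m, A m -> n <= m].
Definition nat_max (A : set nat) : nat :=
  xget 0 [set n | A n /\ forall m, A m -> m <= n].

Section Dehn.
Variable L : choiceType.
Implicit Types (P : presentation L) (W : word L).

Definition min_cells (j : nat) P W : nat :=
  nat_min [set n | exists D : diagram L,
    [/\ diagram_over P D, boundary_label D W & num_cells j D = n]].

Definition dehn (j : nat) P (x : nat) : nat :=
  nat_max [set n | exists W : word L,
    [/\ normal_closure P W, size W <= x & min_cells j P W = n]].

End Dehn.

(* Functions on positive integers: the value at 0 is irrelevant. *)
Definition preceq (f g : nat -> nat) : Prop :=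
  exists2 C, 0 < C & forall x, 0 < x -> f x <= C * g (C * x) + C * x.

Definition simeq (f g : nat -> nat) : Prop := preceq f g /\ preceq g f.

(* Main.v *)
Require Import Defs.
From mathcomp Require Import all_boot finmap.
From mathcomp Require Import boolp classical_sets cardinality.
From mathcomp Require Import perm fingroup zify fintype.

(* The key tool is a quantitative van Kampen lemma: W bounds a diagram with
   2-cells r_1, ..., r_k exactly when W is freely a product of conjugates of the
   r_i, up to dropping some of them in the passage from products to diagrams.
   The number of 2-cells is then k, and the number of edges follows from
   2E = |W| + |r_1| + ... + |r_k|.  Hence writing each of the finitely many
   replaced relators as a product of conjugates of the new ones multiplies the
   numbers of 2-cells and of edges by at most a constant, while V <= E + 1 by
   Euler's formula.  For a stabilization, erasing b from W and wedging a disk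
   with boundary b^{+-1} at each erased letter creates no new vertex.

   From diagrams to products: the polygons are glued along a spanning tree of
   the dual graph, which multiplies their boundary words; planarity forces the
   remaining gluings to pair the sides of the resulting polygon without
   crossings, so its word is freely trivial.  From products to diagrams: words
   are rewritten by inserting and deleting x x^-1 and by splitting off relators,
   and each of these steps is performed on a plane map.  A step may disconnect
   the map, and the component of the outer region is kept at the end; it is a
   sphere because the genus is nonnegative (Ree's inequality). *)

Set Implicit Arguments.
Unset Strict Implicit.
Unset Printing Implicit Defensive.

(** * Components and cycles of permutations *)

Section Components.
Variable T : finType.
Implicit Types (e : rel T) (s n : {perm T}) (x y a b : T).

Definition ccard e := n_comp e T.

(** Each component of [e'] is a union of components of [e], so distinct roots of [e'] have distinct
    roots for [e]. *)
Lemma ccard_le e e' :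
  connect_sym e -> connect_sym e' -> subrel e (connect e') -> ccard e' <= ccard e.
Proof.
move=> se se' /connect_sub ee'; rewrite /ccard /n_comp_mem.
rewrite -(@card_in_image _ _ (root e)).
  apply/subset_leq_card/subsetP => _ /imageP[x _ ->].
  by rewrite !inE roots_root.
move=> x y /andP[/eqP rx _] /andP[/eqP ry _] /(rootP se)/ee' xy.
by rewrite -rx -ry; apply/(rootP se').
Qed.

Lemma ccard_lt e e' a b :
  connect_sym e -> connect_sym e' -> subrel e (connect e') ->
  connect e' a b -> ~~ connect e a b -> ccard e' < ccard e.
Proof.
move=> se se' /connect_sub ee' e'ab neab; rewrite /ccard /n_comp_mem.
rewrite -(@card_in_image _ _ (root e)); last first.
  move=> x y /andP[/eqP rx _] /andP[/eqP ry _] /(rootP se)/ee' xy.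
  by rewrite -rx -ry; apply/(rootP se').
apply/proper_card/properP; split.
  by apply/subsetP => _ /imageP[x _ ->]; rewrite !inE roots_root.
(* If both [root e a] and [root e b] were attained, the common [e']-root of [a] and [b] would link
   them in [e]. *)
pose im := [seq root e x | x in [predI roots e' & T]].
have root' c : root e c \in im -> connect e c (root e' c).
  move=> /imageP[x /andP[/eqP rx _] /(rootP se) cx].
  by rewrite (rootP se' (ee' _ _ cx)) rx.
have [ra|ra] := boolP (root e a \in im);
  last by exists (root e a); rewrite // !inE roots_root.
have [rb|rb] := boolP (root e b \in im);
  last by exists (root e b); rewrite // !inE roots_root.
case/negP: neab; apply: connect_trans (root' _ ra) _.
by rewrite (rootP se' e'ab) se root'.
Qed.

(** The edges of [e'] can merge only the component of [a] with that of [b], so the roots of [e]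
    other than that of [a] lie in distinct components of [e']. *)
Lemma ccard_link e e' a b :
  connect_sym e -> connect_sym e' ->
  (forall x y, e' x y -> connect e x y \/
     [\/ connect e x a /\ connect e y b | connect e x b /\ connect e y a]) ->
  ccard e <= (ccard e').+1.
Proof.
move=> se se' e'e.
(* The alternative passes from edges to paths: crossing between the two components twice leads back
   to the first. *)
have {}e'e x y : connect e' x y -> connect e x y \/
     [\/ connect e x a /\ connect e y b | connect e x b /\ connect e y a].
  case/connectP=> p e'p ->{y}; elim: p x e'p => [|z p IH] x /=; first by left.
  case/andP=> /e'e xz /IH zl; set l := last z p in zl *.
  have tr u v w : connect e u v -> connect e v w ->
    connect e u w by exact: connect_trans.
  case: xz => [xz|[[xa zb]|[xb za]]]; case: zl => [zl|[[za' lb]|[zb' la]]].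
  - by left; apply: tr xz zl.
  - by right; left; split=> //; apply: tr xz za'.
  - by right; right; split=> //; apply: tr xz zb'.
  - by right; left; split=> //; apply: tr _ zb; rewrite se.
  - by left; apply: tr xa (tr _ _ _ _ (tr _ _ _ zb _)); rewrite se.
  - by left; apply: tr xa _; rewrite se.
  - by right; right; split=> //; apply: tr _ za; rewrite se.
  - by left; apply: tr xb _; rewrite se.
  - by left; apply: tr xb (tr _ _ _ _ (tr _ _ _ za _)); rewrite se.
rewrite /ccard /n_comp_mem (cardD1 (root e a)) -[X in _ <= X]add1n.
apply: leq_add; first exact: leq_b1.
rewrite -(@card_in_image _ _ (root e')).
  apply/subset_leq_card/subsetP => _ /imageP[x _ ->].
  by rewrite !inE roots_root.
move=> x y /andP[xa /andP[/eqP rx _]] /andP[ya /andP[/eqP ry _]].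
have {xa}xa : ~ connect e x a by move/(rootP se); rewrite rx => xa';
  rewrite xa' eqxx in xa.
have {ya}ya : ~ connect e y a by move/(rootP se); rewrite ry => ya';
  rewrite ya' eqxx in ya.
by move/(rootP se')/e'e => [/(rootP se)|[[]|[]]] //; rewrite rx ry.
Qed.

End Components.

(** * Cycle counts of products of permutations *)

Section Ree.
Variable T : finType.
Implicit Types (s n : {perm T}) (x y a b : T).

Definition ncyc s := fcard s T.

(** The components of this graph are the orbits of the group generated by [s] and [n]. *)
Definition glink s n : rel T := relU (frel s) (frel n).

Definition gcard s n := ccard (glink s n).

Lemma porbit_fconnect s x y : (y \in porbit s x) = fconnect s x y.
Proof.
apply/porbitP/idP => [[i ->]|/iter_findex <-].
  by rewrite permX fconnect_iter.
by eexists; rewrite -permX.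
Qed.

Lemma ncycE s : ncyc s = #|porbits s|.
Proof.
have ss := fconnect_sym (@perm_inj _ s).
rewrite /ncyc /n_comp_mem -(@card_in_imset _ _ (porbit s)).
  apply: eq_card => c; apply/imsetP/imsetP => -[x _ ->]; first by exists x.
  exists (froot s x); first by rewrite !inE roots_root.
  by apply/eqP; rewrite eq_porbit_mem porbit_sym porbit_fconnect connect_root.
move=> x y /andP[/eqP rx _] /andP[/eqP ry _] /eqP;
  rewrite eq_porbit_mem porbit_fconnect.
by rewrite ss => /(rootP ss); rewrite rx ry.
Qed.

(** A transposition cuts a cycle in two when [x] and [y] both lie on it, and merges their two cycles
    otherwise. The additive form avoids subtraction and covers [x = y]. *)
Lemma ncyc_tperm s x y :
  ncyc (tperm x y * s) + (~~ fconnect s x y).*2 = ncyc s + (x != y).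
Proof. by rewrite !ncycE -porbits_mul_tperm porbit_sym porbit_fconnect. Qed.

Lemma ncyc1 : ncyc 1 = #|T|.
Proof.
rewrite -(fcard_id T); by apply: eq_fcard => x; rewrite perm1.
Qed.

Lemma glink_sym s n : connect_sym (glink s n).
Proof. by apply: relU_sym; apply: fconnect_sym; exact: perm_inj. Qed.

Lemma glinkl s n x : connect (glink s n) x (s x).
Proof. by apply: connect1; rewrite /glink /= eqxx. Qed.

Lemma glinkr s n x : connect (glink s n) x (n x).
Proof. by apply: connect1; rewrite /glink /= eqxx orbT. Qed.

Lemma connect_glink s n (e : rel T) :
  (forall x, connect e x (s x)) -> (forall x, connect e x (n x)) ->
  subrel (connect (glink s n)) (connect e).
Proof. by move=> es en; apply: connect_sub => x y /orP[] /eqP <-. Qed.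

Lemma fconnect_glinkr s n x y : fconnect n x y -> connect (glink s n) x y.
Proof. by apply: connect_sub => {}x _ /eqP <-; exact: glinkr. Qed.

Lemma fconnect_glinkM s n x y : fconnect (s * n)%g x y -> connect (glink s n) x y.
Proof.
apply: connect_sub => {}x _ /eqP <-; rewrite permM.
exact: connect_trans (glinkl _ _ _) (glinkr _ _ _).
Qed.

(* Ree's inequality, i.e. the genus is nonnegative.  Factoring one
   transposition out of s changes each side by at most the same amount. *)
Lemma ree s n : ncyc s + ncyc n + ncyc (s * n) <= #|T| + (gcard s n).*2.
Proof.
move: {2}_.+1 (ltnSn #|[pred x | s x != x]|) => k; elim: k s => // k IH s lek.
have [/existsP[x sx]|/existsPn s1] := boolP [exists x, s x != x]; last first.
  have -> : s = 1%g by apply/permP => x; rewrite perm1; exact/eqP/negPn/s1.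
  rewrite ncyc1 mul1g -addnA addnn leq_add2l leq_double.
  apply: ccard_le; [exact: glink_sym|by apply: fconnect_sym; exact: perm_inj|].
  by move=> x _ /orP[] /eqP <-; rewrite ?perm1 ?connect0 ?fconnect1.
(* Factoring out this transposition makes [y] a fixed point, so [s'] moves fewer points. *)
set y := s x in sx; pose s' : {perm T} := (tperm x y * s)%g.
have s'E : s = (tperm x y * s')%g by rewrite mulgA tperm2 mul1g.
have s'y : s' y = y by rewrite permM tpermR.
have s'x : s' x = s y by rewrite permM tpermL.
have s'D z : z != x -> z != y -> s' z = s z by move=> zx zy;
  rewrite permM tpermD // eq_sym.
have xy : x != y by rewrite eq_sym.
have lek' : #|[pred x | s' x != x]| < k.
  rewrite -ltnS; apply: leq_trans lek; rewrite ltnS [X in _ <= X](cardD1 y) inE.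
  have -> : s y != y by rewrite (inj_eq perm_inj).
  rewrite add1n ltnS; apply/subset_leq_card/subsetP => z; rewrite !inE => sz.
  have zy : z != y by apply: contraNneq sz => ->; rewrite s'y.
  by rewrite zy; have [->|zx] := eqVneq z x; rewrite // -s'D.
have := IH s' lek'.
have nfs : ~~ fconnect s' x y.
  apply/negP; rewrite fconnect_sym; last exact: perm_inj.
  move/iter_findex; elim: (findex _ _ _) => [/eqP|i IHi];
    first by rewrite (negbTE sx).
  by rewrite iterSr s'y.
have cs : ncyc s + 2 = ncyc s' + 1.
  by have := ncyc_tperm s' x y; rewrite -s'E nfs xy.
have csn : ncyc (s * n) + (~~ fconnect (s' * n)%g x y).*2 = ncyc (s' * n) + 1.
  by have := ncyc_tperm (s' * n) x y; rewrite mulgA -s'E xy.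
have sub z : connect (glink s n) z (s' z).
  have sy : connect (glink s n) x (s y).
    exact: connect_trans (glinkl _ _ _) (glinkl _ _ _).
  have [->|zy] := eqVneq z y; first by rewrite s'y.
  by have [->|zx] := eqVneq z x; [rewrite s'x|rewrite s'D ?glinkl].
(* If [s'] and [n] already join [x] to [y], the cycle lost by [s] pays for the at most one gained by
   [s * n]. Otherwise both lose a cycle, which balances the loss of at most one orbit, as orbits
   count twice. *)
have [con|ncon] := boolP (connect (glink s' n) x y).
  have cc : gcard s' n <= gcard s n.
    apply: ccard_le; try exact: glink_sym; move=> z _ /orP[] /eqP <-;
      last exact: glinkr.
    have [->|zx] := eqVneq z x; first by [].
    have [->|zy] := eqVneq z y; last by rewrite -s'D ?glinkl.
    rewrite -s'x; apply: connect_trans (glinkl _ _ _); by rewrite glink_sym.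
  by move: cs csn cc; case: (fconnect _ _ _) => /=; lia.
have nfsn : ~~ fconnect (s' * n)%g x y by apply: contra ncon;
  exact: fconnect_glinkM.
rewrite nfsn in csn.
have cc : gcard s' n <= (gcard s n).+1.
  apply: (@ccard_link _ _ _ x y); try exact: glink_sym.
  move=> z _ /orP[] /eqP <-; last by left; exact: glinkr.
  have [->|zx] := eqVneq z x; first by right; left; rewrite !connect0.
  have [->|zy] := eqVneq z y; last by left; rewrite -s'D ?glinkl.
  by right; right; rewrite connect0 -s'x glink_sym glinkl.
by move: cs csn cc => /=; lia.
Qed.

(** Ree's inequality with the orbits bounded by the cycles of [n]; its equality case is what
    [gword_trivial] assumes. *)
Lemma ncyc_mul s n : ncyc s + ncyc (s * n) <= #|T| + ncyc n.
Proof.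
have := ree s n.
have : gcard s n <= ncyc n.
  apply: ccard_le; [by apply: fconnect_sym; exact: perm_inj|exact: glink_sym|].
  move=> x _ /eqP <-; exact: glinkr.
lia.
Qed.

End Ree.

(** * Products of conjugates *)

Section FreeGroup.
Variable L : choiceType.
Implicit Types (x : letter L) (u v w g r : word L) (rs : seq (word L)).

Lemma linvK : involutive (@linv L).
Proof. by case=> a b; rewrite /linv /= negbK. Qed.

Lemma winv_cat u v : winv (u ++ v) = winv v ++ winv u.
Proof. by rewrite /winv map_cat rev_cat. Qed.

Lemma winvK : involutive (@winv L).
Proof. by move=> u; rewrite /winv map_rev revK mapK //; exact: linvK. Qed.

Lemma size_winv u : size (winv u) = size u.
Proof. by rewrite size_rev size_map. Qed.

Lemma word_over_winv A u : word_over A (winv u) = word_over A u.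
Proof. by rewrite /word_over all_rev all_map. Qed.

Lemma word_over_cat A u v : word_over A (u ++ v) = word_over A u && word_over A v.
Proof. exact: all_cat. Qed.

Lemma free_eq_cat2 p q u v : free_eq u v -> free_eq (p ++ u ++ q) (p ++ v ++ q).
Proof.
elim=> {u v}[w|u v _|u v w _ + _|u x v].
- exact: free_eq_refl.
- exact: free_eq_sym.
- exact: free_eq_trans.
by rewrite -!catA /= !(catA p u); apply: free_eq_cancel.
Qed.

Lemma free_eq_cat u u' v v' : free_eq u u' -> free_eq v v' ->
  free_eq (u ++ v) (u' ++ v').
Proof.
move=> uu vv; apply: (free_eq_trans (v := u' ++ v)).
  exact: (@free_eq_cat2 [::] v).
by have := @free_eq_cat2 u' [::] _ _ vv; rewrite !cats0.
Qed.

Lemma free_eq_catl u v v' : free_eq v v' -> free_eq (u ++ v) (u ++ v').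
Proof. exact: free_eq_cat (free_eq_refl u). Qed.

Lemma free_eq_winv u v : free_eq u v -> free_eq (winv u) (winv v).
Proof.
elim=> {u v}[w|u v _|u v w _ + _|u x v].
- exact: free_eq_refl.
- exact: free_eq_sym.
- exact: free_eq_trans.
rewrite !winv_cat -cat1s -[linv x :: v]cat1s !winv_cat /winv /= linvK -!catA /=.
exact: free_eq_cancel.
Qed.

Lemma free_eq_mulV w : free_eq (w ++ winv w) [::].
Proof.
elim: w => [|x w IH]; first exact: free_eq_refl.
have -> : (x :: w) ++ winv (x :: w) = [:: x] ++ (w ++ winv w) ++ [:: linv x].
  by rewrite -(cat1s x w) winv_cat -!catA.
apply: free_eq_trans (free_eq_cat2 [:: x] [:: linv x] IH) _.
exact: (@free_eq_cancel _ [::] x [::]).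
Qed.

Lemma free_eq_Vmul w : free_eq (winv w ++ w) [::].
Proof. by have := free_eq_mulV (winv w); rewrite winvK. Qed.

Lemma free_eq_mulVK u w : free_eq (u ++ winv u ++ w) w.
Proof.
by have := free_eq_cat2 [::] w (free_eq_mulV u); rewrite /= -catA.
Qed.

Lemma free_eq_mulKV u w : free_eq (winv u ++ u ++ w) w.
Proof. by have := free_eq_mulVK (winv u) w; rewrite winvK. Qed.

(** The list records the conjugated factors in order and with multiplicity, so that its size and
    total length can be counted. Exponents are all 1: an inverse factor is listed as a word of its
    own. *)
Inductive cprod : seq (word L) -> word L -> Prop :=
| cprod_nil : cprod [::] [::]
| cprod_cons r rs g w : cprod rs w -> cprod (r :: rs) (g ++ r ++ winv g ++ w)
| cprod_eq rs w w' : free_eq w w' -> cprod rs w -> cprod rs w'.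

Lemma cprod_cat rs rs' w w' : cprod rs w -> cprod rs' w' ->
  cprod (rs ++ rs') (w ++ w').
Proof.
move=> c c'; elim: c => {rs w}//= [r rs g w _|rs w v wv _].
  by move=> /(cprod_cons r g); rewrite -!catA.
by apply: cprod_eq; apply: free_eq_cat wv (free_eq_refl _).
Qed.

Lemma cprod_conj rs w h : cprod rs w -> cprod rs (h ++ w ++ winv h).
Proof.
move=> c; elim: c => {rs w}[|r rs g w _|rs w v wv _].
- exact: cprod_eq (free_eq_sym (free_eq_mulV _)) cprod_nil.
- move=> /(cprod_cons r (h ++ g)); apply: cprod_eq.
  rewrite winv_cat -!catA; do 4!apply: free_eq_catl.
  exact: free_eq_mulKV.
by apply: cprod_eq; exact: free_eq_cat2.
Qed.

Lemma cprod1 r : cprod [:: r] r.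
Proof. by have := cprod_cons r [::] cprod_nil; rewrite /= cats0. Qed.

Lemma cprod_rot rs u v : cprod rs (u ++ v) -> cprod rs (v ++ u).
Proof.
move/(cprod_conj v); apply: cprod_eq; rewrite -[X in free_eq _ X]cats0 -!catA.
do 2!apply: free_eq_catl; exact: free_eq_mulV.
Qed.

(** Conjugates of products of conjugates are again such products; this is how relators are exchanged
    for others. *)
Lemma cprod_flatten (F : word L -> seq (word L)) rs w :
  (forall r, r \in rs -> cprod (F r) r) -> cprod rs w ->
    cprod (flatten (map F rs)) w.
Proof.
move=> Fr c; elim: c Fr => {rs w}[|r rs g w _ IH|rs w v wv _ IH] Fr.
- exact: cprod_nil.
- rewrite /=; have := cprod_cat (cprod_conj g (Fr r (mem_head _ _))) (IH _).
  by rewrite -!catA; apply=> r' r'rs; apply: Fr; rewrite in_cons r'rs orbT.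
exact: cprod_eq wv (IH Fr).
Qed.

Lemma cprod_winv rs w : cprod rs w -> cprod (map (@winv L) rs) (winv w).
Proof.
move=> c; elim: c => {rs w}[|r rs g w _ IH|rs w v wv _].
- exact: cprod_nil.
- have := cprod_cons (winv r) (winv w ++ g) IH; apply: cprod_eq.
  rewrite !winv_cat !winvK -[X in free_eq _ X]cats0 -!catA.
  by do 4!apply: free_eq_catl; exact: free_eq_mulV.
by apply: cprod_eq; exact: free_eq_winv.
Qed.

End FreeGroup.

(** * Gluing polygons *)

Section CycleSurgery.
Variable T : finType.
Implicit Types (f m : {perm T}) (x y z : T) (u v c : seq T).

Lemma fcycle_catC m u v : fcycle m (u ++ v) = fcycle m (v ++ u).
Proof. by rewrite -rot_size_cat rot_cycle. Qed.

Lemma fcycle_rcons m u x : fcycle m (rcons u x) = path (frel m) x (rcons u x).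
Proof. by rewrite -[X in fcycle _ X]cats1 fcycle_catC. Qed.

Lemma tperm_out m x y z u : x \notin u -> y \notin u -> z \in u ->
  (tperm x y * m)%g z = m z.
Proof.
move=> xu yu zu; rewrite permM tpermD //; first by apply: contraNneq xu => ->.
by apply: contraNneq yu => ->.
Qed.

Lemma path_tperm m x y u : x \notin u -> y \notin u ->
  path (frel (tperm x y * m)%g) x (rcons u x) = path (frel m) y (rcons u x).
Proof.
case: u => [|a u] xu yu /=; first by rewrite permM tpermL.
rewrite permM tpermL; congr (_ && _).
have {xu yu} := tperm_out m xu yu => eqf.
elim: u a eqf => [|b u IH] a eqf /=; first by rewrite eqf ?mem_head.
rewrite eqf ?mem_head //; congr (_ && _); apply: IH => z zu; apply: eqf.
by rewrite in_cons zu orbT.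
Qed.

Lemma fcycle_tperm_out m x y c : x \notin c -> y \notin c ->
  fcycle (tperm x y * m)%g c = fcycle m c.
Proof.
move=> xc yc; apply: (eq_in_cycle (P := mem c)); last exact/allP.
by move=> z t zc _; rewrite /= (tperm_out m xc yc zc).
Qed.

(** [tperm x y * m] exchanges the successors of [x] and [y], and thus joins the cycles that end with
    them. Applied twice, it also describes how a cycle is cut. *)
Lemma fcycle_tperm m x y u v : uniq (rcons u x ++ rcons v y) ->
  fcycle (tperm x y * m)%g (rcons u x ++ rcons v y) =
  fcycle m (rcons u x) && fcycle m (rcons v y).
Proof.
move=> U;
have : [/\ x \notin u, x \notin v, y \notin u & y \notin v].
  move: U; rewrite cat_uniq !rcons_uniq => /and3P[/andP[xu _] /hasPn h /andP[yv _]].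
  split=> //.
    by apply/negP => xv; have := h x;
      rewrite /= !mem_rcons !inE eqxx xv orbT => /(_ isT).
  by have := h y; rewrite /= !mem_rcons !inE eqxx => /(_ isT) /norP[].
case=> xu xv yu yv; set m' := (tperm x y * m)%g.
have := path_tperm m' xu yu; have := path_tperm m' yv xv.
rewrite (tpermC y x) /m' mulgA tperm2 mul1g -/m' !fcycle_rcons => -> ->.
by rewrite -rcons_cat fcycle_rcons rcons_cat cat_path last_rcons.
Qed.

Lemma mem_rconsl x u : x \in rcons u x.
Proof. by rewrite mem_rcons mem_head. Qed.

End CycleSurgery.

Section Gluing.
Variables (L : choiceType) (T : finType) (lab : T -> letter L).
Implicit Types (f m : {perm T}) (x y z : T) (u v c : seq T).

(* Polygons with sides glued one pair at a time: the boundary of the surface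
   obtained so far is given by the cycles of m, in which the fixed points of
   the involution f are the sides already glued. *)
Definition gword f c : word L := [seq lab z | z <- c & f z != z].

Lemma gword_cat f u v : gword f (u ++ v) = gword f u ++ gword f v.
Proof. by rewrite /gword filter_cat map_cat. Qed.

Section OneGluing.
Variables (f m : {perm T}) (x : T).
Hypotheses (fK : involutive f) (fx : f x != x).
Let y := f x.
(** Gluing [x] to [y] makes both fixed by [f']. They remain in the cycles of [m'], but [gword] no
    longer reads them. *)
Let f' : {perm T} := (tperm x y * f)%g.
Let m' : {perm T} := (tperm x y * m)%g.

Let f'x : f' x = x. Proof. by rewrite permM tpermL /y fK. Qed.
Let f'y : f' y = y. Proof. by rewrite permM tpermR. Qed.
Let f'D z : z != x -> z != y -> f' z = f z.
Proof. by move=> zx zy; rewrite permM tpermD // eq_sym. Qed.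

Lemma glue_fix z : (f' z != z) = [&& z != x, z != y & f z != z].
Proof.
have [->|zx] := eqVneq z x; first by rewrite f'x eqxx.
by have [->|zy] := eqVneq z y; [rewrite f'y eqxx|rewrite f'D].
Qed.

Lemma glue_involutive : involutive f'.
Proof.
move=> z; have [->|zx] := eqVneq z x; first by rewrite !f'x.
have [->|zy] := eqVneq z y; first by rewrite !f'y.
rewrite (f'D zx zy) f'D ?fK //; first by rewrite -[X in _ != X]fK (inj_eq perm_inj).
by rewrite (inj_eq perm_inj).
Qed.

(** The transposition of [x] and [f x] commutes with [f], and its two occurrences cancel. So the
    cycles of [f * m], which are the vertices when [f] has no fixed point, are invariant under
    gluing. *)
Lemma glue_mul : (f' * m')%g = (f * m)%g.
Proof.
apply/permP => z; rewrite [LHS]permM [m' _]permM [RHS]permM; congr (m _).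
have [->|zx] := eqVneq z x; first by rewrite f'x tpermL.
have [->|zy] := eqVneq z y; first by rewrite f'y tpermR /y fK.
rewrite (f'D zx zy) tpermD //; first by rewrite eq_sym -[X in _ != X]fK (inj_eq
  perm_inj).
by rewrite eq_sym (inj_eq perm_inj).
Qed.

Lemma glue_ncyc : ncyc f' = (ncyc f).+1.
Proof.
have := ncyc_tperm f x y.
by rewrite -/f' /y fconnect1 (eq_sym x) fx /= addn0 addn1.
Qed.

Lemma gword_glue_out c : x \notin c -> y \notin c -> gword f' c = gword f c.
Proof.
move=> xc yc; rewrite /gword; congr map; apply: eq_in_filter => z zc.
rewrite glue_fix; have -> : z != x by apply: contraNneq xc => <-.
by have -> : z != y by apply: contraNneq yc => <-.
Qed.

Lemma gword_glue1 z : z \in [:: x; y] -> gword f' [:: z] = [::].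
Proof. by rewrite !inE /gword /= => /orP[]/eqP ->; rewrite ?f'x ?f'y eqxx. Qed.

Lemma gword1 z : z \in [:: x; y] -> gword f [:: z] = [:: lab z].
Proof. by rewrite !inE /gword /= => /orP[]/eqP ->; rewrite ?fK 1?(eq_sym x) fx. Qed.

End OneGluing.

(* The Euler characteristic forces every gluing to split a boundary
   component, so that the sides of each cycle of m are paired without
   crossing. *)
Lemma gword_trivial f m :
  involutive f -> (forall z, f z != z -> lab (f z) = linv (lab z)) ->
  ncyc f + ncyc (f * m) = #|T| + ncyc m ->
  forall c, uniq c -> fcycle m c -> cprod [::] (gword f c).
Proof.
move: {2}_.+1 (ltnSn #|[pred x | f x != x]|) => k.
elim: k f m => // k IH f m lek fK labf eul c Uc mc.
have [/hasP[x xc fx]|/hasPn c1] := boolP (has (fun z => f z != z) c); last first.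
  rewrite /gword; have -> : [seq z <- c | f z != z] = [::]; last exact: cprod_nil.
  by apply/eqP; rewrite -[_ == _]negbK -has_filter; apply/hasPn.
pose f' : {perm T} := (tperm x (f x) * f)%g.
pose m' : {perm T} := (tperm x (f x) * m)%g.
have lek' : #|[pred x | f' x != x]| < k.
  rewrite -ltnS; apply: leq_trans lek; rewrite ltnS.
  apply/proper_card/properP; split; last first.
    by exists x; rewrite !inE ?fx // glue_fix // eqxx.
  by apply/subsetP => z; rewrite !inE glue_fix // => /and3P[].
have cf' : ncyc f' = (ncyc f).+1 := glue_ncyc fx.
have mul' : (f' * m' = f * m)%g := glue_mul m x fK.
have tp : ncyc m' + (~~ fconnect m x (f x)).*2 = ncyc m + (x != f x).
  exact: ncyc_tperm.
have bound := ncyc_mul f' m'.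
move: tp bound eul; rewrite mul' cf' (eq_sym x) fx.
(* By [bound] and [eul], [m'] has more cycles than [m], so [x] and [f x] lie on one cycle of [m]. *)
have [xy|] := boolP (fconnect m x (f x)); last by move=> /=; lia.
move=> tp _ eul.
have yc : f x \in c by rewrite -(fconnect_cycle mc xc).
have {}IH := IH f' m' lek' (glue_involutive x fK).
have labf' z : f' z != z -> lab (f' z) = linv (lab z).
  rewrite glue_fix // => /and3P[zx zy fz].
  by rewrite /f' permM tpermD 1?eq_sym // labf.
have {labf'}IH := IH labf'.
have {}IH : forall c, uniq c -> fcycle m' c -> cprod [::] (gword f' c).
  by apply: IH; rewrite mul' cf'; move: tp eul => /=; lia.
case/splitPr: xc yc Uc mc => a b yc Uc mc.
have : cprod [::] (gword f (b ++ rcons a x)).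
  have Uc' : uniq (b ++ rcons a x) by rewrite uniq_catC cat_rcons.
  have mc' : fcycle m (b ++ rcons a x) by rewrite fcycle_catC cat_rcons.
  have : f x \in b ++ a.
    by move: yc; rewrite !mem_cat !inE (negbTE fx) orbC.
  move: Uc' mc'; rewrite -rcons_cat; move: (b ++ a) => d + + yd.
  case/splitPr: yd => u v Uc' mc'.
  have dE : rcons (u ++ f x :: v) x = rcons u (f x) ++ rcons v x.
    by rewrite -cat_rcons rcons_cat.
  rewrite dE in Uc' mc' *.
  have := fcycle_tperm m' Uc'.
  rewrite /m' (tpermC _ x) mulgA tperm2 mul1g mc' => /esym/andP[mu mv].
  move: (Uc'); rewrite cat_uniq => /and3P[Uu hu Uv].
  have := IH _ Uu mu; have := IH _ Uv mv.
  have [xu yu xv yv] : [/\ x \notin u, f x \notin u, x \notin v & f x \notin v].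
    move: Uu Uv hu; rewrite !rcons_uniq => /andP[yu _] /andP[xv _] /hasPn h;
      split=> //.
      by have := h x (mem_rconsl _ _); rewrite /= mem_rcons inE => /norP[].
    by apply/negP => yv; have := h (f x);
      rewrite /= !mem_rcons !inE yv eqxx orbT => /(_ isT).
  rewrite -!cats1 !gword_cat !gword_glue1 ?inE ?eqxx ?orbT // !cats0
    !gword_glue_out //.
  (* The cycle reads $u x^{-1} v x$, where $u$ and $v$ are freely trivial by induction. *)
  move=> cv cu; rewrite (gword1 fK fx) ?inE ?eqxx ?orbT //.
  rewrite (gword1 fK fx) ?inE ?eqxx ?orbT // labf //.
  rewrite -!catA; apply: (@cprod_cat _ [::] [::]) cu _.
  have := cprod_conj [:: linv (lab x)] cv.
  by rewrite /winv /= linvK.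
by rewrite gword_cat => /cprod_rot; rewrite -gword_cat cat_rcons.
Qed.

End Gluing.

Section Merging.
Variables (L : choiceType) (T : finType) (lab : T -> letter L).
Implicit Types (f m : {perm T}) (x y z : T) (u v c : seq T).

Lemma cprod_rot_cons rs (u v w : word L) :
  cprod rs w -> cprod ((u ++ v) :: rs) (v ++ u ++ w).
Proof.
move=> cw; rewrite catA -cat1s.
exact: cprod_cat (cprod_rot (cprod1 _)) cw.
Qed.

(* Polygons are merged along a spanning tree of the dual graph until a single
   one is left, to which gword_trivial applies. *)
Lemma cprod_polygons f m c (cs : seq (seq T)) :
  involutive f -> (forall z, f z != z -> lab (f z) = linv (lab z)) ->
  (forall x y, connect (glink f m) x y) ->
  ncyc f + ncyc m + ncyc (f * m) = #|T| + 2 ->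
  uniq (flatten (c :: cs)) -> all (fcycle m) (c :: cs) ->
  (forall z, z \in flatten (c :: cs)) -> [::] \notin c :: cs ->
  exists2 rs, perm_eq rs (map (gword lab f) cs) & cprod rs (winv (gword lab f c)).
Proof.
have [k] := ubnP (size cs); elim: k f m c cs =>
  // k IH f m c cs lek fK labf conn eul U mcs cov nil.
have [x0 x0c] : exists x0, x0 \in c.
  by case: c nil {U mcs cov} => [|x0 c] _ //; exists x0; rewrite mem_head.
have [Uc Ucs _] : [/\ uniq c, ~~ has (mem c) (flatten cs) & uniq (flatten cs)].
  by apply/and3P; rewrite -cat_uniq.
have mc : fcycle m c by case/andP: mcs.
have [csn|csn] := eqVneq cs [::].
  exists [::]; first by rewrite csn.
  have covc z : z \in c by have := cov z; rewrite csn /= cats0.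
  apply: (@cprod_winv _ [::]); apply: (gword_trivial fK labf _ Uc mc).
  (* With a single polygon left, the sphere formula becomes the equality required by
     [gword_trivial]. *)
  have m1 : ncyc m = 1.
    rewrite -(n_comp_connect (fconnect_sym (@perm_inj _ m)) x0).
    apply: eq_n_comp_r => z; rewrite [RHS](fconnect_cycle mc) ?covc //.
  by move: eul; rewrite m1; lia.
(* Some side of [c] is paired with a side of another polygon; otherwise [c] would be a whole
   component, against connectedness. *)
have [/hasP[x xc yc]|/hasPn stay] := boolP (has (fun z => f z \notin c) c);
  last first.
  case: cs csn nil Ucs {U lek mcs cov} => // c1 cs _;
    rewrite !inE !negb_or -!(eq_sym c1) => /and3P[_ c1n _].
  rewrite /= has_cat => /norP[/hasPn h _].
  case: c1 c1n h => // z c1 _ h; case/negP: (h z (mem_head _ _)).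
  have cl : closed (glink f m) (mem c).
    apply: intro_closed; first exact: glink_sym.
    move=> p q /orP[] /eqP <- pc; last exact: (mem_fcycle mc).
    exact/negPn/stay.
  by rewrite /= -(closed_connect cl (conn x0 z)).
have fx : f x != x by apply: contraNneq yc => ->.
have /flattenP[c1 c1cs yc1] : f x \in flatten cs.
  by have := cov (f x); rewrite /= mem_cat (negbTE yc).
have pcs := perm_to_rem c1cs; set cs1 := rem c1 cs in pcs.
have nxy : ~~ fconnect m x (f x) by rewrite (fconnect_cycle mc).
have [a [b cE]] : exists a b, c = a ++ x :: b by case/splitPr: xc => a b;
  exists a, b.
have [a1 [b1 c1E]] : exists a b,
  c1 = a ++ f x :: b by case/splitPr: yc1 => a1 b1; exists a1, b1.
set y := f x in yc yc1 nxy c1E.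
(* Rotated to end with the sides to be glued, [c] and [c1] merge into [c2]. The sphere formula
   survives: [f] gains a cycle and [m] loses one. *)
pose u := b ++ a; pose v := b1 ++ a1; pose c2 := rcons u x ++ rcons v y.
have p2 : perm_eq (flatten (c :: cs)) (flatten (c2 :: cs1)).
  have -> : flatten (c :: cs) = c ++ flatten cs by [].
  rewrite (perm_trans (y := c ++ c1 ++ flatten cs1)) ?perm_cat2l ?(perm_flatten
    pcs) //.
  rewrite catA /= perm_cat2r /c2 cE c1E /u /v.
  by apply: perm_cat; rewrite -cat_rcons perm_catC rcons_cat perm_refl.
have [Uc2 out _] : [/\ uniq c2, ~~ has (mem c2) (flatten cs1) & uniq (flatten cs1)].
  by apply/and3P; rewrite -cat_uniq -(perm_uniq p2).
have mc1 : fcycle m c1 by apply: (allP mcs); rewrite in_cons c1cs orbT.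
pose f' : {perm T} := (tperm x y * f)%g.
pose m' : {perm T} := (tperm x y * m)%g.
have m'c2 : fcycle m' c2.
  rewrite fcycle_tperm // /u /v !rcons_cat.
  by rewrite fcycle_catC cat_rcons -cE mc fcycle_catC cat_rcons -c1E.
have xc2 : x \in c2 by rewrite mem_cat mem_rconsl.
have yc2 : y \in c2 by rewrite mem_cat mem_rconsl orbT.
have out1 z d : z \in c2 -> d \in cs1 -> z \notin d.
  move=> zc2 dcs; apply/negP => zd; case/hasP: out; exists z => //.
  by apply/flattenP; exists d.
have tp : ncyc m' + 2 = ncyc m + 1.
  by have := ncyc_tperm m x y; rewrite nxy (eq_sym x) fx.
have cf' : ncyc f' = (ncyc f).+1 := glue_ncyc fx.
have mul' : (f' * m' = f * m)%g := glue_mul m x fK.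
have labf' z : f' z != z -> lab (f' z) = linv (lab z).
  rewrite glue_fix // => /and3P[zx zy fz].
  by rewrite /f' permM tpermD 1?eq_sym // labf.
have xy' : connect (glink f' m') x y.
  by apply: fconnect_glinkr; rewrite (fconnect_cycle m'c2).
have yx' : connect (glink f' m') y x by rewrite glink_sym.
have conn' p q : connect (glink f' m') p q.
  move: p q (conn p q); apply: connect_glink => z.
    have [->//|zx] := eqVneq z x; have [->|zy] := eqVneq z y;
      first by rewrite /y fK.
    by have := glinkl f' m' z; rewrite {2}/f' permM tpermD // eq_sym.
  have [->|zx] := eqVneq z x.
    by apply: connect_trans xy' _; have := glinkr f' m' y;
      rewrite {2}/m' permM tpermR.
  have [->|zy] := eqVneq z y.
    by apply: connect_trans yx' _; have := glinkr f' m' x;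
      rewrite {2}/m' permM tpermL.
  by have := glinkr f' m' z; rewrite {2}/m' permM tpermD // eq_sym.
have [||||||rs0 prs0 crs0] := IH f' m' c2 cs1 _ (glue_involutive x fK) labf' conn'.
- by rewrite (perm_size pcs) in lek.
- by rewrite mul' cf'; move: tp eul; clear; lia.
- by rewrite -(perm_uniq p2).
- rewrite [all _ _]/= m'c2; apply/allP => d dcs.
  rewrite fcycle_tperm_out ?out1 //; apply: (allP mcs).
  by rewrite in_cons (perm_mem pcs) in_cons dcs !orbT.
- by move=> z; rewrite -(perm_mem p2).
- rewrite in_cons negb_or; apply/andP; split.
    by rewrite /c2 -cats1 -catA; case: (u).
  by apply: contra nil => h; rewrite in_cons (perm_mem pcs) in_cons h !orbT.
have w2 : gword lab f' c2 = gword lab f b ++ gword lab f a ++ gword lab f b1 ++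
  gword lab f a1.
  have : [/\ x \notin u, y \notin u, x \notin v & y \notin v].
    move: Uc2; rewrite cat_uniq !rcons_uniq =>
      /and3P[/andP[xu _] /hasPn h /andP[yv _]].
    split=> //.
      by have := h y (mem_rconsl _ _); rewrite /= mem_rcons inE => /norP[].
    by apply/negP => xv; have := h x;
      rewrite /= !mem_rcons !inE xv eqxx orbT => /(_ isT).
  case=> xu yu xv yv.
  have eu : gword lab f' u = gword lab f u by exact: gword_glue_out.
  have ev : gword lab f' v = gword lab f v by exact: gword_glue_out.
  rewrite /u /v !gword_cat in eu ev.
  rewrite /c2 -!cats1 !gword_cat !gword_glue1 ?inE ?eqxx ?orbT // !cats0.
  by rewrite eu ev -!catA.
exists (gword lab f c1 :: rs0).
  rewrite perm_sym (perm_trans (perm_map _ pcs)) //= perm_cons perm_sym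
    (perm_trans prs0) //.
  have -> // : map (gword lab f') cs1 = map (gword lab f) cs1.
  by apply/eq_in_map => d dcs; rewrite gword_glue_out ?out1.
have wx : gword lab f [:: x] = [:: lab x] by rewrite (gword1 lab fK fx) ?inE ?eqxx.
have wy : gword lab f [:: y] = [:: linv (lab x)].
  by rewrite (gword1 lab fK fx) ?inE ?eqxx ?orbT // -labf.
(* The word $x^{-1} b_1 a_1$, a rotation of that of [c1], is multiplied by $(b a b_1 a_1)^{-1}$;
   what is left is a rotation of $(a x b)^{-1}$. *)
have := cprod_rot_cons (gword lab f a1) ([:: linv (lab x)] ++ gword lab f b1) crs0.
rewrite w2 cE c1E -(cat1s x b) -(cat1s y b1) !gword_cat wx wy !winv_cat -!catA =>
  cw.
apply: cprod_rot; apply: cprod_eq cw.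
apply: (@free_eq_catl _ [:: linv (lab x)]).
apply: free_eq_trans (free_eq_catl _ (free_eq_mulVK _ _)) _; exact: free_eq_mulVK.
Qed.

End Merging.

(** * Plane maps *)

Section Split.
Variables (T T1 T2 : finType) (h1 : T1 -> T) (h2 : T2 -> T).
Hypotheses (h1_inj : injective h1) (h2_inj : injective h2).
Hypothesis h_disj : forall x y, h1 x != h2 y.
Hypothesis h_cover : forall z, (exists x, z = h1 x) \/ (exists y, z = h2 y).

Let im1 z : (z \in codom h1) = ~~ (z \in codom h2).
Proof.
case: (h_cover z) => [[x ->]|[y ->]]; rewrite codom_f.
  by apply/esym/negP => /codomP[y /eqP]; apply/negP.
by apply/negP => /codomP[x /eqP]; rewrite eq_sym; apply/negP.
Qed.

Lemma ccard_split (e : rel T) (e1 : rel T1) (e2 : rel T2) :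
  connect_sym e -> connect_sym e1 -> connect_sym e2 ->
  (forall x y, e (h1 x) (h1 y) = e1 x y) ->
    (forall x y, e (h2 x) (h2 y) = e2 x y) ->
  (forall x y, ~~ e (h1 x) (h2 y)) -> (forall x y, ~~ e (h2 x) (h1 y)) ->
  ccard e = ccard e1 + ccard e2.
Proof.
move=> se se1 se2 ee1 ee2 n12 n21; rewrite /ccard (n_compC (mem (codom h1))).
have cl : closed e (mem (codom h1)).
  apply: intro_closed => // x y xy /= /codomP[x1 xE]; rewrite xE in xy.
  case: (h_cover y) => [[y1 ->]|[y2 yE]]; first exact: codom_f.
  by rewrite yE (negbTE (n12 _ _)) in xy.
congr (_ + _).
  rewrite (adjunction_n_comp h1 se se1 cl); last exact: strict_adjunction.
  by apply: eq_n_comp_r => x; rewrite !inE codom_f.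
have cl' : closed e [predC (mem (codom h1))] by exact: predC_closed.
rewrite (adjunction_n_comp h2 se se2 cl'); last first.
  apply: strict_adjunction => //.
  by apply/subsetP => x; rewrite !inE im1 negbK.
by apply: eq_n_comp_r => x; rewrite !inE im1 codom_f.
Qed.

Section Perms.
Variables (s n : {perm T}) (s1 n1 : {perm T1}) (s2 n2 : {perm T2}).
Hypotheses (sh1 : forall x, s (h1 x) = h1 (s1 x)) (sh2 : forall x,
  s (h2 x) = h2 (s2 x)).
Hypotheses (nh1 : forall x, n (h1 x) = h1 (n1 x)) (nh2 : forall x,
  n (h2 x) = h2 (n2 x)).

Lemma ncyc_split : ncyc s = ncyc s1 + ncyc s2.
Proof.
apply: ccard_split; try by apply: fconnect_sym; exact: perm_inj.
- by move=> x y; rewrite /= sh1 (inj_eq h1_inj).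
- by move=> x y; rewrite /= sh2 (inj_eq h2_inj).
- by move=> x y; rewrite /= sh1.
- by move=> x y; rewrite /= sh2 eq_sym.
Qed.

Lemma gcard_split : gcard s n = gcard s1 n1 + gcard s2 n2.
Proof.
apply: ccard_split; try exact: glink_sym.
- by move=> x y; rewrite /glink /= sh1 nh1 !(inj_eq h1_inj).
- by move=> x y; rewrite /glink /= sh2 nh2 !(inj_eq h2_inj).
- by move=> x y; rewrite /glink /= sh1 nh1 negb_or !h_disj.
- by move=> x y; rewrite /glink /= sh2 nh2 negb_or ![h2 _ == _]eq_sym !h_disj.
Qed.

End Perms.

Lemma card_split : #|T| = #|T1| + #|T2|.
Proof.
rewrite -(cardC (mem (codom h1))) card_codom //; congr (_ + _).
by rewrite -(card_codom h2_inj); apply: eq_card => x; rewrite !inE im1 negbK.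
Qed.

End Split.

(** * Planarity under changes of faces *)

Section Planar.

(** Equality in [ree]. When [e] is the edge involution, the cycles of [e], [n] and [e * n] are the
    edges, faces and vertices, and equality says that every component is a sphere. *)
Definition planar (T : finType) (e n : {perm T}) : Prop :=
  ncyc e + ncyc n + ncyc (e * n) = #|T| + (gcard e n).*2.

(** Both sides of Ree's inequality are additive, so equality for the union forces equality for each
    part. *)
Lemma planar_split (T T1 T2 : finType) (h1 : T1 -> T) (h2 : T2 -> T)
    (e n : {perm T}) (e1 n1 : {perm T1}) (e2 n2 : {perm T2}) :
  injective h1 -> injective h2 -> (forall x y, h1 x != h2 y) ->
  (forall z, (exists x, z = h1 x) \/ (exists y, z = h2 y)) ->
  (forall x, e (h1 x) = h1 (e1 x)) -> (forall x, e (h2 x) = h2 (e2 x)) ->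
  (forall x, n (h1 x) = h1 (n1 x)) -> (forall x, n (h2 x) = h2 (n2 x)) ->
  planar e n <-> planar e1 n1 /\ planar e2 n2.
Proof.
move=> i1 i2 dj cv eh1 eh2 nh1 nh2; rewrite /planar.
rewrite (ncyc_split i1 i2 dj cv eh1 eh2) (ncyc_split i1 i2 dj cv nh1 nh2).
rewrite (gcard_split i1 i2 dj cv eh1 eh2 nh1 nh2) (card_split i1 i2 dj cv).
have -> : ncyc (e * n) = ncyc (e1 * n1) + ncyc (e2 * n2).
  by apply: (ncyc_split i1 i2 dj cv) => x; rewrite !permM ?eh1 ?eh2 ?nh1 ?nh2.
have := ree e1 n1; have := ree e2 n2; split; [move=> ?; split|case]; lia.
Qed.

Variable T : finType.
Implicit Types (e n : {perm T}) (a b x y z : T).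

Lemma ncyc_invol e : involutive e -> (forall d, e d != d) -> (ncyc e).*2 = #|T|.
Proof.
move=> eK efp; rewrite -muln2 -(@fcard_order_set _ _ (@perm_inj _ e) 2 predT) //.
apply/subsetP => x _; rewrite inE.
have Ux : uniq [:: x; e x] by rewrite /= inE eq_sym efp.
by rewrite (order_cycle (p := [:: x; e x])) ?mem_head //= eK !eqxx.
Qed.

Lemma fconnect_tperm n x y : x != y -> ~~ fconnect n x y ->
  fconnect (tperm x y * n)%g x y.
Proof.
move=> xy nxy; have := ncyc_tperm (tperm x y * n) x y; have := ncyc_tperm n x y.
by rewrite mulgA tperm2 mul1g xy nxy; case: (fconnect _ _ _) => //=; lia.
Qed.

(** A transposition applied to the faces acts on the vertices as a transposition too, so
    [ncyc_tperm] counts both. *)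
Lemma mul_tperm_conj e n a b : involutive e ->
  (e * (tperm a b * n) = tperm (e a) (e b) * (e * n))%g.
Proof.
move=> eK; apply/permP => z; rewrite !permM; congr (n _).
case: tpermP => [<-|<-|za zb]; rewrite ?eK ?tpermL ?tpermR //.
by case: tpermP => // E; [case: za|case: zb]; rewrite E eK.
Qed.

(** The face is pinched at the ends of [a] and [b], which adds one face. If the two ends are the
    same vertex, that vertex is split and a component is gained; otherwise two vertices merge. In
    both cases [ree] excludes genus. *)
Lemma planar_divide e n a b : involutive e -> planar e n -> fconnect n a b ->
  a != b ->
  planar e (tperm a b * n).
Proof.
move=> eK pl nab ab; set n' : {perm T} := (tperm a b * n)%g.
have cn : ncyc n' = ncyc n + 1.
  by have := ncyc_tperm n a b; rewrite nab ab addn0.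
have eab : e a != e b by rewrite (inj_eq perm_inj).
have := ncyc_tperm (e * n) (e a) (e b); rewrite -mul_tperm_conj // eab -/n' => cen.
have n'a : n' a = n b by rewrite permM tpermL.
have n'b : n' b = n a by rewrite permM tpermR.
have n'D z : z != a -> z != b -> n' z = n z by move=> za zb;
  rewrite permM tpermD // eq_sym.
have g1 : gcard e n' <= (gcard e n).+1.
  apply: (@ccard_link _ _ _ a b); try exact: glink_sym.
  move=> x y /orP[] /eqP <-; first by left; exact: glinkl.
  have [->|xa] := eqVneq x a; first by right; left;
    rewrite connect0 -n'b glink_sym glinkr.
  have [->|xb] := eqVneq x b; first by right; right;
    rewrite connect0 -n'a glink_sym glinkr.
  by left; rewrite -n'D ?glinkr.
have := ree e n'; move: pl; rewrite /planar cn; move: cen.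
have [_|nab'] := boolP (fconnect _ _ _); first by move: g1 => /=; lia.
have abn' : connect (glink e n') a b.
  have := fconnect_tperm eab nab';
    rewrite -mul_tperm_conj // -/n' => /fconnect_glinkM h.
  apply: connect_trans (glinkl _ _ _) (connect_trans h _);
    by rewrite glink_sym glinkl.
have g0 : gcard e n' <= gcard e n.
  apply: ccard_le; try exact: glink_sym.
  move=> x y /orP[] /eqP <-; first exact: glinkl.
  have [->|xa] := eqVneq x a; first by rewrite -n'b;
    apply: connect_trans abn' (glinkr _ _ _).
  have [->|xb] := eqVneq x b; last by rewrite -n'D ?glinkr.
  by rewrite -n'a; apply: connect_trans (glinkr _ _ _); rewrite glink_sym.
by move: g0 => /=; lia.
Qed.

(** Two components are wedged together at the ends of [a] and [b]: one face, one vertex and one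
    component are lost. *)
Lemma planar_join e n a b : involutive e -> planar e n ->
  ~~ connect (glink e n) a b ->
  planar e (tperm a b * n).
Proof.
move=> eK pl nab; set n' : {perm T} := (tperm a b * n)%g.
have ab : a != b by apply: contraNneq nab => ->; exact: connect0.
have fab : ~~ fconnect n a b by apply: contra nab; exact: fconnect_glinkr.
have cn : ncyc n' + 2 = ncyc n + 1.
  by have := ncyc_tperm n a b; rewrite fab ab.
have eab : e a != e b by rewrite (inj_eq perm_inj).
have feab : ~~ fconnect (e * n)%g (e a) (e b).
  apply: contra nab => /fconnect_glinkM h.
  apply: connect_trans (glinkl _ _ _) (connect_trans h _);
    by rewrite glink_sym glinkl.
have cen : ncyc (e * n') + 2 = ncyc (e * n) + 1.
  by have := ncyc_tperm (e * n) (e a) (e b); rewrite -mul_tperm_conj // eab feab.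
have abn' := fconnect_glinkr e (fconnect_tperm ab fab).
rewrite -/n' in abn'.
have g1 : gcard e n' < gcard e n.
  apply: (@ccard_lt _ _ _ a b) => //; try exact: glink_sym.
  move=> x y /orP[] /eqP <-; first exact: glinkl.
  have [->|xa] := eqVneq x a.
    by have := glinkr e n' b; rewrite permM tpermR; apply: connect_trans abn'.
  have [->|xb] := eqVneq x b.
    have := glinkr e n' a; rewrite permM tpermL; apply: connect_trans;
      by rewrite glink_sym.
  by have := glinkr e n' x; rewrite permM tpermD // eq_sym.
by have := ree e n'; move: pl cn cen g1; rewrite /planar; clear; lia.
Qed.

End Planar.

Section PlaneMaps.
Variable L : choiceType.
Implicit Types (w : word L) (ws : seq (word L)).

(* A possibly disconnected plane map whose listed faces cs form a union of
   components; the remaining darts are discarded spheres. *)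
Record plane_map (T : finType) (lab : T -> letter L) (e n : {perm T})
    (cs : seq (seq T)) : Prop := PlaneMap {
  pm_invol : involutive e;
  pm_fpf : forall d, e d != d;
  pm_lab : forall d, lab (e d) = linv (lab d);
  pm_planar : planar e n;
  pm_uniq : uniq (flatten cs);
  pm_cycle : all (fcycle n) cs;
  pm_closed : forall d, d \in flatten cs -> e d \in flatten cs
}.

(** Empty words are allowed, as empty lists of darts, so that a face can be rewritten down to
    nothing. *)
Definition realizable ws : Prop :=
  exists (T : finType) (lab : T -> letter L) (e n : {perm T}) (cs : seq (seq T)),
    plane_map lab e n cs /\ ws = map (map lab) cs.

Section Faces.
Variables (T : finType) (lab : T -> letter L) (e n : {perm T}).

Lemma plane_map_perm cs cs' : perm_eq cs cs' ->
  plane_map lab e n cs -> plane_map lab e n cs'.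
Proof.
move=> pcs [eK efp labe pl U cyc cl]; have pf := perm_flatten pcs.
split=> //; first by rewrite -(perm_uniq pf).
  by rewrite -(perm_all _ pcs).
by move=> d; rewrite -!(perm_mem pf); exact: cl.
Qed.

Lemma plane_map_rot u v cs :
  plane_map lab e n ((u ++ v) :: cs) -> plane_map lab e n ((v ++ u) :: cs).
Proof.
case=> eK efp labe pl U cyc cl.
have pf : perm_eq (flatten ((u ++ v) :: cs)) (flatten ((v ++ u) :: cs)).
  by rewrite /= perm_cat2r perm_catC.
split=> //; first by rewrite -(perm_uniq pf).
  by move: cyc => /= /andP[c ->]; rewrite fcycle_catC c.
by move=> d; rewrite -!(perm_mem pf); exact: cl.
Qed.

Lemma plane_map_split x y u v cs :
  plane_map lab e n ((rcons u x ++ rcons v y) :: cs) ->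
  plane_map lab e (tperm x y * n) (rcons u x :: rcons v y :: cs).
Proof.
case=> eK efp labe pl; rewrite [flatten _]/= => U /andP[cyc cycs] cl.
have [Uc out _] : [/\ uniq (rcons u x ++ rcons v y),
    ~~ has (mem (rcons u x ++ rcons v y)) (flatten cs) & uniq (flatten cs)].
  by apply/and3P; rewrite -cat_uniq.
have xy : x != y.
  move: Uc; rewrite cat_uniq => /and3P[_ /hasPn h _]; have := h _ (mem_rconsl y v).
  by rewrite /= mem_rcons inE eq_sym => /norP[].
have nxy : fconnect n x y.
  by rewrite (fconnect_cycle cyc) ?mem_cat ?mem_rconsl ?orbT.
split=> //.
- exact: planar_divide.
- by rewrite /= catA.
- rewrite /= andbA -fcycle_tperm // mulgA tperm2 mul1g cyc.
  apply/allP => d dcs; rewrite fcycle_tperm_out; first exact: (allP cycs).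
    apply: contra out => xd; apply/hasP; exists x;
      last by rewrite /= mem_cat mem_rconsl.
    by apply/flattenP; exists d.
  apply: contra out => xd; apply/hasP; exists y;
    last by rewrite /= mem_cat mem_rconsl orbT.
  by apply/flattenP; exists d.
- by rewrite /= catA.
Qed.

(* Gluing the two outer sides of a bigon turns it into a sphere of its own. *)
Lemma plane_map_bigon x y cs : lab y = linv (lab x) ->
  plane_map lab e n ([:: x; y] :: cs) -> exists e', plane_map lab e' n cs.
Proof.
move=> lxy [eK efp labe pl]; rewrite [flatten _]/= => U /andP[/= cyc cycs] cl.
move: U; rewrite !cons_uniq in_cons negb_or => /and3P[/andP[xy xcs] ycs U].
move: cyc; rewrite andbT => /andP[/eqP nx /eqP ny].
(* Sides already paired with each other form a component of their own, which is simply no longer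
   listed. *)
have [exy|exy] := eqVneq (e x) y.
  exists e; split=> // d dcs.
  have := cl d; rewrite !inE dcs !orbT => /(_ isT) /or3P[/eqP edx|/eqP edy|//].
    by move: ycs; rewrite -exy -edx eK dcs.
  by move: xcs; rewrite -[x]eK exy -edy eK dcs.
set a := e x; set b := e y.
have ax : a != x := efp x.
have by' : b != y := efp y.
have ay : a != y := exy.
have bx : b != x by apply: contraNneq exy => <-; rewrite /b eK.
have ba : b != a by rewrite (inj_eq perm_inj) eq_sym.
(* [e'] pairs [x] with [y] and their former partners [a] and [b] with each other. *)
pose e' : {perm T} := (tperm x b * (tperm y a * e))%g.
have e'x : e' x = y by rewrite !permM tpermL tpermD ?eK // eq_sym.
have e'b : e' b = a by rewrite !permM tpermR tpermD // eq_sym.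
have e'y : e' y = x by rewrite !permM (tpermD (x := x)) // tpermL eK.
have e'a : e' a = b by rewrite !permM (tpermD (x := x)) 1?(eq_sym x) // tpermR.
have e'D z : z != x -> z != y -> z != a -> z != b -> e' z = e z.
  by move=> zx zy za zb; rewrite !permM !tpermD // eq_sym.
have e4 (Q : T -> T -> Prop) : Q x y -> Q y x -> Q a b -> Q b a ->
    (forall z, z != x -> z != y -> z != a -> z != b -> Q z (e z)) ->
      forall z, Q z (e' z).
  move=> Qx Qy Qa Qb Q' z; have [->|zx] := eqVneq z x; first by rewrite e'x.
  have [->|zy] := eqVneq z y; first by rewrite e'y.
  have [->|za] := eqVneq z a; first by rewrite e'a.
  by have [->|zb] := eqVneq z b; [rewrite e'b|rewrite e'D //; exact: Q'].
have e'K : involutive e'.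
  move=> z; apply: (e4 (fun z t => e' t = z)) => // {}z zx zy za zb;
    rewrite e'D ?eK //.
  - by rewrite -[x]eK (inj_eq perm_inj).
  - by rewrite -[y]eK (inj_eq perm_inj).
  - by rewrite (inj_eq perm_inj).
  - by rewrite (inj_eq perm_inj).
have e'fp z : e' z != z.
  by apply: (e4 (fun z t => t != z)) => //; rewrite eq_sym.
have ce : ncyc e' = ncyc e.
  by apply: double_inj; rewrite !ncyc_invol.
(* Two vertices are gained and at most one component, so Ree's inequality forces planarity. *)
have cen : ncyc (e' * n) = ncyc (e * n) + 2.
  have -> : (e' * n = tperm x b * (tperm y a * (e * n)))%g by rewrite /e' !mulgA.
  have := ncyc_tperm (tperm y a * (e * n)) x b; have := ncyc_tperm (e * n) y a.
  have -> : fconnect (e * n)%g y a.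
    rewrite fconnect_sym; last exact: perm_inj.
    by have := fconnect1 (e * n)%g a; rewrite permM /a eK nx.
  have -> : fconnect (tperm y a * (e * n))%g x b.
    rewrite fconnect_sym; last exact: perm_inj.
    have := fconnect1 (tperm y a * (e * n))%g b.
    by rewrite !permM tpermD 1?eq_sym // /b eK ny.
  by rewrite (eq_sym y) ay (eq_sym x) bx /=; clear; lia.
have g1 : gcard e' n <= (gcard e n).+1.
  apply: (@ccard_link _ _ _ x a); try exact: glink_sym.
  have sym p q : connect (glink e' n) p q ->
    connect (glink e' n) q p by rewrite glink_sym.
  have yx : connect (glink e' n) y x by rewrite -ny glinkr.
  have ba' : connect (glink e' n) b a by rewrite -e'b glinkl.
  move=> z t /orP[] /eqP <-; last by left; exact: glinkr.
  have [->|zx] := eqVneq z x; first by right; left; rewrite !connect0.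
  have [->|zy] := eqVneq z y; first by right; left.
  have [->|za] := eqVneq z a; first by right; right; rewrite /a eK !connect0.
  have [->|zb] := eqVneq z b; first by right; right; rewrite /b eK.
  by left; rewrite -e'D ?glinkl.
exists e'; split=> //.
- apply: (e4 (fun z t => lab t = linv (lab z))) => //.
  + by rewrite lxy linvK.
  + by rewrite /a /b !labe lxy.
  + by rewrite /a /b !labe lxy linvK.
- by have := ree e' n; move: pl; rewrite /planar ce cen; move: g1; clear; lia.
- move=> d dcs; have dx : d != x by apply: contraNneq xcs => <-.
  have dy : d != y by apply: contraNneq ycs => <-.
  have inb z : z \in flatten cs -> e z != x -> e z != y -> e z \in flatten cs.
    move=> zcs zx zy; have := cl z; rewrite !inE zcs !orbT => /(_ isT).
    by rewrite (negbTE zx) (negbTE zy).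
  have cl2 z : z \in [:: x; y] -> e z != x -> e z != y -> e z \in flatten cs.
    move=> zxy zx zy; have := cl z; rewrite !in_cons orbA -!in_cons.
    by rewrite !inE in zxy *; rewrite zxy (negbTE zx) (negbTE zy) => /(_ isT).
  have [->|da] := eqVneq d a; first by rewrite e'a cl2 ?inE ?eqxx ?orbT.
  have [->|db] := eqVneq d b; first by rewrite e'b cl2 ?inE ?eqxx ?orbT.
  rewrite e'D // inb //; first by rewrite -[x]eK (inj_eq perm_inj).
  by rewrite -[y]eK (inj_eq perm_inj).
Qed.

End Faces.
End PlaneMaps.

(** * Disks, disjoint unions and wedges *)

Section Surgery.
Variable L : choiceType.
Implicit Types (w : word L) (ws : seq (word L)).

Lemma map_cat_inv (S S' : Type) (f : S -> S') (c : seq S) (u v : seq S') :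
  map f c = u ++ v -> exists c1 c2, [/\ c = c1 ++ c2, map f c1 = u & map f c2 = v].
Proof.
move=> fc; exists (take (size u) c), (drop (size u) c).
by rewrite cat_take_drop map_take map_drop fc take_size_cat ?drop_size_cat.
Qed.

Lemma fcycle_map (T T1 : finType) (h : T1 -> T) (s : {perm T}) (s1 : {perm T1}) c :
  injective h -> (forall x, s (h x) = h (s1 x)) -> fcycle s (map h c) = fcycle s1 c.
Proof.
by move=> hi sh; rewrite cycle_map; apply: eq_cycle => x y /=;
  rewrite sh (inj_eq hi).
Qed.

Lemma sub_perm_exists (T : finType) (p : pred T) (s : {perm T}) :
  (forall x, p x -> p (s x)) -> exists s1 : {perm {x | p x}}, forall x,
    s (val x) = val (s1 x).
Proof.
move=> ps; pose s1 (x : {x | p x}) : {x | p x} := Sub (s (val x)) (ps _ (valP x)).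
have s1i : injective s1 by move=> x y /(congr1 val) /= /perm_inj /val_inj.
by exists (perm s1i) => x; rewrite permE SubK.
Qed.

Lemma sum_perm_exists (T1 T2 : finType) (s1 : {perm T1}) (s2 : {perm T2}) :
  exists s : {perm T1 + T2}, (forall x, s (inl x) = inl (s1 x)) /\
                             (forall x, s (inr x) = inr (s2 x)).
Proof.
pose s (z : T1 + T2) := match z with inl x => inl (s1 x) | inr y => inr (s2 y) end.
have si : injective s by move=> [x|x] [y|y] //= [] /perm_inj ->.
by exists (perm si); split=> x; rewrite permE.
Qed.

Definition connected_map (T : finType) (e n : {perm T}) :=
  forall x y, connect (glink e n) x y.

(** The darts of the listed faces are closed under [e] and [n], hence fill a connected map as soon
    as there is one. *)
Lemma plane_map_cover (T : finType) (lab : T -> letter L) e n c cs :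
  plane_map lab e n (c :: cs) -> connected_map e n -> c != [::] ->
  forall z, z \in flatten (c :: cs).
Proof.
case=> eK efp labe pl U cyc cl con cn z.
have [x0 x0c] : exists x0, x0 \in c by case: c cn {U cyc cl} => // x0 c _;
     exists x0; rewrite mem_head.
have cl' : closed (glink e n) (mem (flatten (c :: cs))).
  apply: intro_closed; first exact: glink_sym.
  move=> x y /orP[] /eqP <-; first exact: cl.
  move=> /flattenP[d dcs xd]; apply/flattenP; exists d => //.
  exact: (mem_fcycle (allP cyc _ dcs)).
by have := closed_connect cl' (con x0 z); rewrite /= => <-; rewrite mem_cat x0c.
Qed.

(* The first face is the outer one. *)
Definition disk w ws : Prop :=
  (w = [::] /\ ws = [::]) \/
  exists (T : finType) (lab : T -> letter L) (e n : {perm T}) (c : seq T)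
    (cs : seq (seq T)),
    [/\ plane_map lab e n (c :: cs), connected_map e n, [::] \notin c :: cs,
        w = map lab c & ws = map (map lab) cs].

Lemma plane_map_sum (T1 T2 : finType) (lab1 : T1 -> letter L)
    (lab2 : T2 -> letter L) e1 n1 cs1 e2 n2 cs2 :
  plane_map lab1 e1 n1 cs1 -> plane_map lab2 e2 n2 cs2 ->
  exists (lab : T1 + T2 -> letter L) e n,
    [/\ plane_map lab e n (map (map inl) cs1 ++ map (map inr) cs2),
        lab \o inl =1 lab1, lab \o inr =1 lab2,
        (forall x, e (inl x) = inl (e1 x)) /\ (forall x, e (inr x) = inr (e2 x)) &
        (forall x, n (inl x) = inl (n1 x)) /\ (forall x, n (inr x) = inr (n2 x))].
Proof.
case=> eK1 efp1 labe1 pl1 U1 cyc1 cl1 [eK2 efp2 labe2 pl2 U2 cyc2 cl2].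
have [e [el er]] := sum_perm_exists e1 e2.
have [n [nl nr]] := sum_perm_exists n1 n2.
exists (fun z => match z with inl x => lab1 x | inr y => lab2 y end), e, n.
have inlI : injective (@inl T1 T2) by move=> x y [].
have inrI : injective (@inr T1 T2) by move=> x y [].
have fl : flatten (map (map inl) cs1 ++ map (map inr) cs2) =
    map inl (flatten cs1) ++ map (@inr T1 T2) (flatten cs2).
  by rewrite flatten_cat !map_flatten.
split=> //; split.
- by move=> [x|x]; rewrite ?el ?er ?eK1 ?eK2.
- by move=> [x|x]; rewrite ?el ?er ?(inj_eq inlI) ?(inj_eq inrI).
- by move=> [x|x]; rewrite ?el ?er.
- apply/(planar_split inlI inrI _ _ el er nl nr) => // -[x|x]; [left|right];
  by exists x.
- rewrite fl cat_uniq !map_inj_uniq // U1 U2 andbT;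
  apply/hasPn => _ /mapP[x _ ->] /=.
  by apply/negP => /mapP[].
- rewrite all_cat !all_map; apply/andP; split.
    by apply: sub_all cyc1 => c; rewrite /= (fcycle_map _ inlI nl).
  by apply: sub_all cyc2 => c; rewrite /= (fcycle_map _ inrI nr).
- move=> z; rewrite fl !mem_cat => /orP[] /mapP[x xcs ->]; rewrite ?el ?er.
    by rewrite map_f ?cl1.
  by rewrite (map_f _ (cl2 _ _)) ?orbT.
Qed.

Lemma plane_map_join (T : finType) (lab : T -> letter L) e n x y u v cs :
  plane_map lab e n (rcons u x :: rcons v y :: cs) -> ~~ connect (glink e n) x y ->
  plane_map lab e (tperm x y * n) ((rcons u x ++ rcons v y) :: cs).
Proof.
case=> eK efp labe pl; rewrite [flatten _]/= catA => U /and3P[cu cv cycs] cl nxy.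
have [Uc out _] : [/\ uniq (rcons u x ++ rcons v y),
    ~~ has (mem (rcons u x ++ rcons v y)) (flatten cs) & uniq (flatten cs)].
  by apply/and3P; rewrite -cat_uniq.
split=> //; first exact: planar_join.
rewrite /= fcycle_tperm // cu cv; apply/allP => d dcs.
rewrite fcycle_tperm_out; first exact: (allP cycs).
  apply: contra out => xd; apply/hasP; exists x;
    last by rewrite /= mem_cat mem_rconsl.
  by apply/flattenP; exists d.
apply: contra out => xd; apply/hasP; exists y;
  last by rewrite /= mem_cat mem_rconsl orbT.
by apply/flattenP; exists d.
Qed.

Lemma connect_glink_map (T T1 : finType) (h : T1 ->
  T) (e n : {perm T}) (e1 n1 : {perm T1}) :
  (forall x, e (h x) = h (e1 x)) -> (forall x, n (h x) = h (n1 x)) ->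
  forall x y, connect (glink e1 n1) x y -> connect (glink e n) (h x) (h y).
Proof.
move=> eh nh x y /connectP[p + ->]; elim: p x => [|z p IH] x /=;
  first by rewrite connect0.
case/andP=> /orP[] /eqP <- /IH; apply: connect_trans.
  by rewrite -eh glinkl.
by rewrite -nh glinkr.
Qed.

(** A disjoint union followed by a join at the last darts of the two first faces, which become one
    face. *)
Lemma plane_map_wedge (T1 T2 : finType) (lab1 : T1 -> letter L)
    (lab2 : T2 -> letter L) e1 n1 c1 cs1 e2 n2 c2 cs2 :
  plane_map lab1 e1 n1 (c1 :: cs1) -> plane_map lab2 e2 n2 (c2 :: cs2) ->
  c1 != [::] -> c2 != [::] ->
  exists (lab : T1 + T2 -> letter L) e n,
    [/\ plane_map lab e n ((map inl c1 ++ map inr c2) :: map (map inl) cs1 ++ map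
      (map inr) cs2),
        lab \o inl =1 lab1, lab \o inr =1 lab2 &
        connected_map e1 n1 -> connected_map e2 n2 -> connected_map e n].
Proof.
move=> P1 P2; case/lastP: c1 P1 => // u x P1 _; case/lastP: c2 P2 => // v y P2 _.
have [lab [e [n [P labl labr [el er] [nl nr]]]]] := plane_map_sum P1 P2.
have nxy : ~~ connect (glink e n) (inl x) (inr y).
  have cl : closed (glink e n) [pred z : T1 + T2 | if z is inl _ then true else
    false].
    apply: intro_closed; first exact: glink_sym.
    by move=> [a|a] z /orP[] /eqP <-; rewrite !inE ?el ?nl.
  by apply/negP => /(closed_connect cl); rewrite !inE.
have {}P : plane_map lab e n (map inl (rcons u x) :: map inr (rcons v y) ::
    map (map inl) cs1 ++ map (map inr) cs2).
  apply: plane_map_perm P; rewrite /= perm_cons.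
  by rewrite -[in X in perm_eq X _]cat_rcons -cats1 -catA perm_catCA.
rewrite !map_rcons in P *; have PJ := plane_map_join P nxy.
exists lab, e, (tperm (inl x) (inr y) * n)%g; split=> // con1 con2.
case: (PJ) => _ _ _ _ _ /= /andP[cJ _] _.
set n' : {perm _} := (_ * n)%g in cJ *.
have xy' : connect (glink e n') (inl x) (inr y).
  by apply: fconnect_glinkr; rewrite (fconnect_cycle cJ) ?mem_cat ?mem_rconsl ?orbT.
have yx' : connect (glink e n') (inr y) (inl x) by rewrite glink_sym.
have sub : subrel (connect (glink e n)) (connect (glink e n')).
  apply: connect_glink => z; first exact: glinkl.
  have [->|zx] := eqVneq z (inl x).
    by apply: connect_trans xy' _; have := glinkr e n' (inr y);
      rewrite {2}/n' permM tpermR.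
  have [->|zy] := eqVneq z (inr y).
    by apply: connect_trans yx' _; have := glinkr e n' (inl x);
      rewrite {2}/n' permM tpermL.
  by have := glinkr e n' z; rewrite {2}/n' permM tpermD // eq_sym.
have conl a b : connect (glink e n') (inl a) (inl b).
  by apply: sub; apply: connect_glink_map (con1 a b).
have conr a b : connect (glink e n') (inr a) (inr b).
  by apply: sub; apply: connect_glink_map (con2 a b).
move=> [a|a] [b|b] //.
  exact: connect_trans (conl a x) (connect_trans xy' (conr y b)).
exact: connect_trans (conr a y) (connect_trans yx' (conl x b)).
Qed.

End Surgery.

(** * Rewriting the boundary words of plane maps *)

Section Realizable.
Variable L : choiceType.
Implicit Types (u v w : word L) (ws rs : seq (word L)).

Lemma gcard_connected (T : finType) (e n : {perm T}) (x : T) :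
  connected_map e n -> gcard e n = 1.
Proof.
move=> con; rewrite -(n_comp_connect (glink_sym e n) x); apply: eq_n_comp_r => y.
by rewrite [RHS]con.
Qed.

(** A single edge with distinct ends on the sphere: [n = e], and [e * n] is the identity, with two
    vertices. *)
Lemma edge_map (x : letter L) : exists (lab : bool -> letter L) (e n : {perm bool}),
  [/\ plane_map lab e n [:: [:: true; false]], connected_map e n,
      lab true = x & lab false = linv x].
Proof.
pose e : {perm bool} := perm negb_inj.
have eE z : e z = ~~ z by rewrite permE.
have eK : involutive e by move=> z; rewrite !eE negbK.
have efp d : e d != d by rewrite eE; case: d.
have con : connected_map e e.
  have tf : connect (glink e e) true false by have := glinkl e e true; rewrite eE.
  by move=> [] [] //; rewrite ?connect0 // glink_sym.
have ce : ncyc e = 1 by apply: double_inj; rewrite ncyc_invol // card_bool.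
exists (fun b => if b then x else linv x), e, e; split=> //; split=> //.
- by move=> [] /=; rewrite eE //= linvK.
- rewrite /planar (gcard_connected true con) ce card_bool.
  have -> : (e * e = 1)%g by apply/permP => z; rewrite permM perm1 eK.
  by rewrite ncyc1 card_bool.
- by rewrite /= !eE.
- by move=> []; rewrite eE.
Qed.

(** A single loop on the sphere: [n] is the identity, giving two faces of length one and one
    vertex. *)
Lemma loop_map (x : letter L) : exists (lab : bool -> letter L) (e n : {perm bool}),
  [/\ plane_map lab e n [:: [:: true]; [:: false]], connected_map e n,
      lab true = x & lab false = linv x].
Proof.
pose e : {perm bool} := perm negb_inj.
have eE z : e z = ~~ z by rewrite permE.
have eK : involutive e by move=> z; rewrite !eE negbK.
have efp d : e d != d by rewrite eE; case: d.
have con : connected_map e 1%g.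
  have tf : connect (glink e 1%g) true false by have := glinkl e 1%g true;
    rewrite eE.
  by move=> [] [] //; rewrite ?connect0 // glink_sym.
have ce : ncyc e = 1 by apply: double_inj; rewrite ncyc_invol // card_bool.
exists (fun b => if b then x else linv x), e, 1%g; split=> //; split=> //.
- by move=> [] /=; rewrite eE //= linvK.
- by rewrite /planar (gcard_connected true con) mulg1 ce ncyc1 card_bool.
- by rewrite /= !perm1.
- by move=> []; rewrite eE.
Qed.

Lemma realizable_rot u v ws : realizable ((u ++ v) :: ws) ->
  realizable ((v ++ u) :: ws).
Proof.
case=> T [lab [e [n [[|c cs] [P]]]]] // [/esym/map_cat_inv[c1 [c2 [cE <- <-]]] ->].
exists T, lab, e, n, ((c2 ++ c1) :: cs); split; last by rewrite /= map_cat.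
by apply: plane_map_rot; rewrite -cE.
Qed.

Lemma realizable_split u v ws : realizable ((u ++ v) :: ws) ->
  realizable [:: u, v & ws].
Proof.
case=> T [lab [e [n [[|c cs] [P]]]]] // [/esym/map_cat_inv[c1 [c2 [cE <- <-]]] ->].
subst c; case/lastP: c1 P => [|c1 a] P.
  by exists T, lab, e, n, ([::] :: c2 :: cs); split=> //; case: P.
case/lastP: c2 P => [|c2 b] P.
  exists T, lab, e, n, (rcons c1 a :: [::] :: cs); split=> //.
  by move: P; rewrite cats0 => -[].
exists T, lab, e, (tperm a b * n)%g, (rcons c1 a :: rcons c2 b :: cs); split=> //.
exact: plane_map_split.
Qed.

Lemma realizable_bigon (x : letter L) ws : realizable ([:: x;
  linv x] :: ws) -> realizable ws.
Proof.
case=> T [lab [e [n [[|[|a [|b [|d t]]] cs] [P]]]]] // [ax bx ->].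
have lb : lab b = linv (lab a) by rewrite -bx ax.
have [e' P'] := plane_map_bigon lb P.
by exists T, lab, e', n, cs.
Qed.

(** An edge with a free end is attached inside the first face. *)
Lemma realizable_insert u (x : letter L) v ws :
  realizable ((u ++ v) :: ws) -> realizable ((u ++ x :: linv x :: v) :: ws).
Proof.
move=> /realizable_rot [T [lab [e [n [[|c cs] [P]]]]]] // [cE ->].
suff : realizable ((v ++ u ++ [:: x; linv x]) :: map (map lab) cs).
  move=> /(@realizable_rot v) [T' [lab' [e' [n' [cs' [P' E]]]]]].
  by exists T', lab', e', n', cs'; split=> //; rewrite -E -catA.
have map2 (T1 T2 : finType) (h : T1 -> T2) (l1 : T1 -> letter L) (l2 : T2 ->
  letter L) ds :
    l2 \o h =1 l1 -> map (map l2) (map (map h) ds) = map (map l1) ds.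
  move=> l12; rewrite -map_comp; apply: eq_map => d /=.
  by rewrite -map_comp; exact: eq_map.
have [lab' [e' [n' [P' _ tE fE]]]] := edge_map x.
(* An empty face offers no vertex to attach the edge to, so the edge is added as a separate
   component. *)
have [c0|cn] := eqVneq c [::].
  have [lab2 [e2 [n2 [P2 l1 l2 _ _]]]] := plane_map_sum P' P.
  exists _, lab2, e2, n2, ([:: inl true; inl false] :: map (map inr) cs);
    split=> //.
    by move: P2; rewrite c0 /= => -[].
  move: cE; rewrite c0 /= (map2 _ _ _ _ _ cs l2); case: v => [|//];
    case: u => [|//] _ /=.
  by congr (_ :: _); rewrite -fE -tE -!l1.
have [lab2 [e2 [n2 [P2 l1 l2 _]]]] := plane_map_wedge P P' cn isT.
do 5!eexists; split; first exact: P2.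
rewrite /= cats0 map_cat catA cE (map2 _ _ _ _ _ cs l1) -map_comp;
  congr ((_ ++ _) :: _).
  exact/esym/eq_map.
by rewrite /= -fE -tE -!l2.
Qed.

(** The subword is split off as a bigon, which is then closed up and discarded. *)
Lemma realizable_delete u (x : letter L) v ws :
  realizable ((u ++ x :: linv x :: v) :: ws) -> realizable ((u ++ v) :: ws).
Proof.
move=> /realizable_rot /(@realizable_split [:: x; linv x]) /realizable_bigon.
exact: realizable_rot.
Qed.

Lemma realizable_free_eq u v : free_eq u v ->
  forall q ws, realizable ((u ++ q) :: ws) <-> realizable ((v ++ q) :: ws).
Proof.
elim=> {u v} [w|u v _ IH|u v w _ IH1 _ IH2|u x v] q ws //.
- by rewrite IH.
- by rewrite IH1.
by rewrite -!catA; split; [exact: realizable_delete|exact: realizable_insert].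
Qed.

Lemma realizable_nil : realizable [:: [::] : word L].
Proof.
have P : forall f : void -> letter L, plane_map f 1 1 [:: [::]].
  move=> f; split=> //; try by case.
  have z (A : pred void) : #|A| = 0 by apply: eq_card0; case.
  by rewrite /planar /gcard /ccard /ncyc /n_comp_mem !z.
by exists _, (fun x : void => match x with end), 1%g, 1%g, [:: [::]].
Qed.

(** Each factor [r] is split off the first face as a face of its own, after which its conjugators
    meet and cancel. *)
Lemma realizable_cprod rs w : cprod rs w ->
  forall v ws, realizable ((w ++ v) :: ws) ->
  exists2 ws', perm_eq ws' (rs ++ ws) & realizable (v :: ws').
Proof.
elim=> {rs w} [|r rs g w _ IH|rs w w' ww' _ IH] v ws.
- by exists ws.
- move=> H; have {H} : realizable ((g ++ (r ++ winv g ++ w ++ v)) :: ws) by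
  rewrite -!catA in H.
  move=> /realizable_rot; rewrite -catA => /realizable_rot /realizable_split.
  rewrite -!catA => /realizable_rot; rewrite -!catA catA => /realizable_rot;
    rewrite -catA catA.
  move=> /(realizable_free_eq (free_eq_mulV g)) /= /IH[ws' pws' rws'].
  exists ws' => //; apply: perm_trans pws' _.
  by rewrite -cat1s perm_catCA.
by move=> /(realizable_free_eq ww'); exact: IH.
Qed.

Lemma pmap_val (T : finType) (p : pred T) (c : seq T) : all p c ->
  map val (pmap insub c : seq {x | p x}) = c.
Proof.
move=> pc; rewrite (pmap_filter (insubK _)); apply/all_filterP.
by apply: sub_all pc => z pz; rewrite insubT.
Qed.

(** The map is restricted to the component of a dart [d0] of the first face, which exists as [w] is
    nonempty. Faces of other components are dropped. *)
Lemma realizable_disk w ws : w <> [::] -> realizable (w :: ws) ->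
  exists2 ws', subseq ws' ws & disk w ws'.
Proof.
move=> wn [T [lab [e [n [[|c cs] [P]]]]]] // [wE wsE].
have [d0 xc] : exists d0, d0 \in c.
  by case: c wE {P} => [//|d0 c] _; exists d0; exact: mem_head.
case: (P) => eK efp labe pl U cyc cl.
pose p z := connect (glink e n) d0 z.
have pe z : p z -> p (e z) by move=> px; apply: connect_trans px (glinkl _ _ _).
have pn z : p z -> p (n z) by move=> px; apply: connect_trans px (glinkr _ _ _).
have pN (s : {perm T}) : (forall x, connect (glink e n) x (s x)) ->
    forall x, ~~ p x -> ~~ p (s x).
  move=> ss x; apply: contra => psx; apply: connect_trans psx _.
  by rewrite glink_sym.
have [e1 e1E] := sub_perm_exists pe; have [n1 n1E] := sub_perm_exists pn.
have [e2 e2E] := sub_perm_exists (pN e (glinkl e n)).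
have [n2 n2E] := sub_perm_exists (pN n (glinkr e n)).
(* The map is the disjoint union of this component and the rest, so the component is planar. *)
have [pl1 _] : planar e1 n1 /\ planar e2 n2.
  apply/(planar_split val_inj val_inj _ _ e1E e2E n1E n2E) => //.
    by move=> x y; apply: contraNneq (valP y) => <-; exact: valP.
  move=> z; have [pz|pz] := boolP (p z); [left|right]; by exists (Sub z pz);
    rewrite SubK.
pose sel := [seq d <- cs | has p d].
pose sub d : seq {x | p x} := pmap insub d.
have pall d : d \in c :: cs -> has p d -> all p d.
  move=> dcs /hasP[z zd pz]; apply/allP => t td; apply: connect_trans pz _.
  by apply: fconnect_glinkr; rewrite (fconnect_cycle (allP cyc _ dcs)).
have pc : all p c by apply: pall (mem_head _ _) _; apply/hasP; exists d0 => //;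
  exact: connect0.
have psel d : d \in c :: sel -> all p d /\ d \in c :: cs.
  rewrite !in_cons mem_filter => /orP[/eqP ->|/andP[pd dcs]]; first by rewrite eqxx.
  by rewrite dcs orbT; split=> //; apply: pall => //; rewrite in_cons dcs orbT.
have vE : map (map val) (map sub (c :: sel)) = c :: sel.
  rewrite -map_comp -[RHS]map_id; apply/eq_in_map => d /psel[pd _]; exact: pmap_val.
have inE' z : (z \in flatten (map sub (c :: sel))) = (val z \in flatten (c :: cs)).
  rewrite -(mem_map val_inj) map_flatten [X in flatten X]vE.
  apply/flattenP/flattenP => -[d dcs zd]; exists d => //;
    first by case: (psel d dcs).
  move: dcs; rewrite !in_cons mem_filter => /orP[->//|dcs]; rewrite dcs andbT.
  by apply/orP; right; apply/hasP; exists (val z) => //; exact: valP.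
exists (map (map lab) sel); first by rewrite wsE map_subseq // filter_subseq.
right; exists {x | p x}, (lab \o val), e1, n1, (sub c), (map sub sel).
have mapE d : d \in c :: sel -> map (lab \o val) (sub d) = map lab d.
  by move=> /psel[pd _]; rewrite map_comp pmap_val.
split.
- split=> //.
  + by move=> z; apply: val_inj; rewrite -!e1E eK.
  + by move=> z; rewrite -(inj_eq val_inj) -e1E efp.
  + by move=> z; rewrite /= -e1E labe.
  + rewrite -(map_inj_uniq val_inj) map_flatten [X in flatten X]vE.
    apply: subseq_uniq U; rewrite /= cat_subseq // /sel; elim: (cs) => //= d ds IH.
    by case: ifP => _ /=; [rewrite cat_subseq|rewrite (subseq_trans IH) //
      suffix_subseq].
  + apply/(@allP _ _ (map sub (c :: sel))) => _ /mapP[d dcs ->];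
    rewrite -(fcycle_map _ val_inj n1E).
    by have [pd dcs'] := psel d dcs; rewrite pmap_val //; exact: (allP cyc).
  + by move=> z; rewrite !inE' -e1E; exact: cl.
- have h1 z : connect (glink e1 n1) (Sub d0 (connect0 _ _)) z.
    have /connectP[q qp qz] : p (val z) := valP z.
    elim/last_ind: q z qp qz => [|q y IH] z.
      by move=> _ zx; rewrite (_ : z = Sub d0 (connect0 _ _)) ?connect0 //;
        apply: val_inj.
    rewrite rcons_path last_rcons => /andP[qp yq] zy.
    have py : p (last d0 q) by apply/connectP; exists q.
    apply: connect_trans (IH (Sub _ py) qp _) _ => //.
    by rewrite connect1 // /glink /= -!(inj_eq val_inj) -e1E -n1E zy.
  by move=> y z; apply: connect_trans (h1 z); rewrite glink_sym.
- apply/negP => /(@mapP _ _ sub (c :: sel))[d dcs dE]; have [pd _] := psel d dcs.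
  have dn : d = [::] by rewrite -(pmap_val pd) -/(sub d) -dE.
  by move: dcs; rewrite dn /sel in_cons mem_filter orbF => /eqP c0;
    rewrite -c0 in xc.
- by rewrite mapE ?mem_head.
- rewrite -map_comp; apply/eq_in_map => d dcs /=.
  by rewrite mapE // in_cons dcs orbT.
Qed.

(** A face reading $w^{-1}w$ is realizable, being freely trivial. Consuming $w^{-1}$ as a product of
    conjugates of the inverted factors leaves an outer face reading $w$. Discarded components
    account for the inequalities. *)
Lemma disk_of_cprod rs w : cprod rs w ->
  exists ws, [/\ disk w ws, {subset ws <= map (@winv L) rs},
                 size ws <= size rs & size (flatten ws) <= size (flatten rs)].
Proof.
move=> cw; have [->|/eqP wn] := eqVneq w [::].
  by exists [::]; split=> //; left.
have r0 : realizable [:: winv w ++ w].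
  have := (realizable_free_eq (free_eq_Vmul w) [::] [::]).2 realizable_nil.
  by rewrite cats0.
have [ws' pws' rws'] := realizable_cprod (cprod_winv cw) r0.
have [ws sws dws] := realizable_disk wn rws'.
exists ws; split=> //.
- by move=> r /(mem_subseq sws); rewrite (perm_mem pws') cats0.
- by rewrite (leq_trans (size_subseq sws)) // (perm_size pws') cats0 size_map.
have szf (s t : seq (word L)) : subseq s t -> size (flatten s) <= size (flatten t).
  elim: t s => [|d ds IH] [|d' s] //=; case: eqP => [->|_] /IH /=;
    rewrite !size_cat.
    by rewrite leq_add2l.
  by move=> h; rewrite (leq_trans h) ?leq_addl.
apply: leq_trans (szf _ _ sws) _.
rewrite (perm_size (perm_flatten pws')) cats0; elim: (rs) => //= r s IH.
by rewrite !size_cat size_winv leq_add2l.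
Qed.

(** The inverse appears because every face, the outer one included, is read with its region on the
    left. *)
Lemma cprod_of_disk w ws : disk w ws ->
  exists2 rs, perm_eq rs ws & cprod rs (winv w).
Proof.
case=> [[-> ->]|[T [lab [e [n [c [cs [P con nil -> ->]]]]]]]].
  by exists [::] => //; exact: cprod_nil.
have cn : c != [::] by move: nil; rewrite in_cons negb_or eq_sym => /andP[].
have cov := plane_map_cover P con cn.
have [d0 _] : exists d0, d0 \in c by case: c cn {P nil cov} => // d0 c _;
  exists d0; rewrite mem_head.
case: P => eK efp labe pl U cyc cl.
(* At the start no side is glued, as [e] has no fixed point. *)
have gE d : gword lab e d = map lab d.
  by rewrite /gword; congr map; apply/all_filterP/allP => z _; exact: efp.
have eul : ncyc e + ncyc n + ncyc (e * n) = #|T| + 2.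
  by rewrite pl (gcard_connected d0 con).
have [] := cprod_polygons eK (fun z _ => labe z) con eul U cyc cov nil.
move=> rs prs crs; exists rs; last by rewrite -gE.
by rewrite (perm_trans prs) // (eq_map gE).
Qed.

Lemma disk_rot u v ws : disk (u ++ v) ws -> disk (v ++ u) ws.
Proof.
case=> [[uv ->]|[T [lab [e [n [c [cs [P con nil + ->]]]]]]]].
  by case: u v uv => [|//] [|//] _; left.
move=> /esym/map_cat_inv[c1 [c2 [cE <- <-]]]; subst c; right.
exists T, lab, e, n, (c2 ++ c1), cs; split=> //; last by rewrite map_cat.
  exact: plane_map_rot.
by move: nil; rewrite !in_cons ![[::] == _ ++ _]eq_sym -!size_eq0 !size_cat addnC.
Qed.

(** A loop is wedged to the boundary. The 2-cell inside it lies to the left of the opposite dart,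
    hence reads [linv x]. *)
Lemma disk_loop (x : letter L) w ws : disk w ws ->
  disk (w ++ [:: x]) (ws ++ [:: [:: linv x]]).
Proof.
have [lab' [e' [n' [P' con' tE fE]]]] := loop_map x.
case=> [[-> ->]|[T [lab [e [n [c [cs [P con nil -> ->]]]]]]]].
  right; do 6!eexists; split; [exact: P'|exact: con'|by []| |].
    by rewrite /= tE.
  by rewrite /= fE.
have cn : c != [::] by move: nil; rewrite in_cons negb_or eq_sym => /andP[].
have [lab2 [e2 [n2 [P2 l1 l2 con2]]]] := plane_map_wedge P P' cn isT.
right; do 6!eexists; split; [exact: P2|exact: con2| | |].
- rewrite in_cons negb_or mem_cat negb_or; apply/and3P; split=> //.
    by case: (c) cn.
  apply/negP => /mapP[d dcs dE]; move: nil; rewrite in_cons negb_or => /andP[_].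
  by case: d dE dcs => // _ ->.
- rewrite map_cat -map_comp; congr (_ ++ _); first exact/esym/eq_map.
  by rewrite /= -tE -l2.
- rewrite map_cat; congr (_ ++ _); last by rewrite /= -fE -l2.
  rewrite -map_comp; apply: eq_map => d /=; rewrite -map_comp; exact/esym/eq_map.
Qed.

End Realizable.

(** * Diagrams *)

Section Diagrams.
Variable L : choiceType.
Implicit Types (u v w : word L) (ws rs : seq (word L)) (P : presentation L).

Lemma cyclic_permxx w : cyclic_perm w w.
Proof. by exists 0; rewrite rot0. Qed.

Lemma cyclic_perm_trans u v w : cyclic_perm u v -> cyclic_perm v w ->
  cyclic_perm u w.
Proof.
move=> [i ->] [j ->]; rewrite rot_minn (rot_minn j) size_rot rot_add_mod
  ?geq_minr //.
by eexists.
Qed.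

Lemma cyclic_perm_sym u v : cyclic_perm u v -> cyclic_perm v u.
Proof. by move=> [i ->]; exists (size (rot i v) - i); rewrite -/(rotr i _) rotK.
  Qed.

Lemma cyclic_perm_winv u v : cyclic_perm u v -> cyclic_perm (winv u) (winv v).
Proof.
move=> [i ->]; apply: cyclic_perm_sym; exists (size (winv (take i v))).
have -> : rot i v = drop i v ++ take i v by [].
by rewrite winv_cat rot_size_cat -winv_cat cat_take_drop.
Qed.

Lemma size_cyclic_perm u v : cyclic_perm u v -> size u = size v.
Proof. by move=> [i ->]; rewrite size_rot. Qed.

Lemma cprod_cyclic rs u v : cyclic_perm u v -> cprod rs v -> cprod rs u.
Proof. by move=> [i ->]; rewrite -{1}(cat_take_drop i v); exact: cprod_rot. Qed.

Lemma disk_cyclic ws u v : cyclic_perm u v -> disk v ws -> disk u ws.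
Proof. by move=> [i ->]; rewrite -{1}(cat_take_drop i v); exact: disk_rot. Qed.

(** The words that may be read around a 2-cell; unlike the relators, they are closed under inversion
    and rotation. *)
Definition relator_label P r : Prop :=
  exists2 s, relators P s & cyclic_perm r s \/ cyclic_perm r (winv s).

Lemma relator_label_winv P r : relator_label P r -> relator_label P (winv r).
Proof.
case=> s Ps [] /cyclic_perm_winv rs; exists s => //; [by right|by left;
  rewrite winvK in rs].
Qed.

Lemma relator_label_neq0 P r : relator_label P r -> r <> [::].
Proof.
case=> s Ps rs r0; case: (relatorsP Ps) => s0 _ _; apply: s0; apply/size0nil.
by case: rs => /size_cyclic_perm; rewrite ?size_winv r0.
Qed.

Lemma word_over_cyclic A u v : cyclic_perm u v -> word_over A u = word_over A v.
Proof. by move=> [i ->]; apply: perm_all; rewrite perm_rot. Qed.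

Lemma relator_label_over P r : relator_label P r -> word_over (alphabet P) r.
Proof.
case=> s Ps rs; case: (relatorsP Ps) => _ os _.
by case: rs => /word_over_cyclic ->; rewrite ?word_over_winv.
Qed.

Lemma ncyc_classes (T S : finType) (s : {perm T}) (g : T -> S) :
  (forall x y, g x = g y <-> fconnect s x y) -> (forall z, exists x, g x = z) ->
  ncyc s = #|S|.
Proof.
move=> gE gonto; have ss := fconnect_sym (@perm_inj _ s).
rewrite /ncyc /n_comp_mem -(@card_in_image _ _ g); last first.
  by move=> x y /andP[/eqP rx _] /andP[/eqP ry _] /gE /(rootP ss); rewrite rx ry.
apply: eq_card => z; rewrite [RHS]inE; apply/imageP; have [x <-] := gonto z.
by exists (froot s x); [rewrite !inE roots_root|apply/gE; exact: connect_root].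
Qed.

Lemma ncyc_cycles (T : finType) (n : {perm T}) cs :
  uniq (flatten cs) -> all (fcycle n) cs -> [::] \notin cs ->
  (forall z, z \in flatten cs) -> ncyc n = size cs.
Proof.
move=> U cyc nil cov.
have -> : ncyc n = n_comp (frel n) (mem (flatten cs)).
  by apply: eq_n_comp_r => z; rewrite [RHS]cov.
elim: cs {cov} U cyc nil => [|c cs IH] /=.
  by move=> _ _ _; apply: eq_card0 => z; rewrite !inE andbF.
rewrite cat_uniq in_cons negb_or =>
  /and3P[Uc /hasPn out U] /andP[cyc cycs] /andP[cn nil].
have [x0 x0c] : exists x0, x0 \in c by case: c cn {Uc cyc out} => // x0 c _;
  exists x0; rewrite mem_head.
rewrite -(IH U cycs nil) -[in RHS]add1n -(n_comp_connect (fconnect_sym (@perm_inj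
  _ n)) x0).
rewrite /n_comp_mem -(cardID (mem c)); congr (_ + _); apply: eq_card => z;
  rewrite !inE /= mem_cat.
  rewrite [connect _ _ _](fconnect_cycle cyc) //.
  by case: (z \in c); rewrite ?andbT ?andbF.
have [zc|zc] := boolP (z \in c); rewrite /= ?andbT //.
by have [/out|_] := boolP (z \in flatten cs); rewrite ?andbF //= zc.
Qed.

Lemma size_cover (T : finType) (s : seq T) : uniq s -> (forall z, z \in s) ->
  #|T| = size s.
Proof. by move=> U cov; rewrite -(card_uniqP U); apply/esym/eq_card => z;
  rewrite cov. Qed.

Lemma uniq_flatten_map (I T : eqType) (F : I -> seq T) (s : seq I) :
  uniq s -> (forall i, uniq (F i)) -> (forall i j x, x \in F i -> x \in F j ->
    i = j) ->
  uniq (flatten (map F s)).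
Proof.
move=> + UF kF; elim: s => //= i s IH /andP[is_ Us].
rewrite cat_uniq UF IH // andbT; apply/hasPn => x /flatten_mapP[j js xj].
by apply: contra is_ => xi; rewrite (kF i j x).
Qed.

(** * From diagrams to connected plane maps *)

Section FromDiagram.
Variable D : diagram L.

Let e : {perm dart D} := perm (can_inj (@einvK _ D)).
Let n : {perm dart D} := perm (@next_inj _ D).

Let eE d : e d = einv d. Proof. by rewrite permE. Qed.
Let nE d : n d = Defs.next d. Proof. by rewrite permE. Qed.

Lemma diagram_connected : connected_map e n.
Proof.
have same d d' : org d = org d' -> connect (glink e n) d d'.
  move=> /org_orbit; apply: connect_sub => {}d _ /eqP <- /=.
  by rewrite -eE -nE; apply: connect_trans (glinkl _ _ _) (glinkr _ _ _).
move=> d d'; have /connectP[p] := diag_connected (org d) (org d').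
elim: p d => [|t p IH] d /=; first by move=> _ /esym; exact: same.
move=> /andP[/existsP[z /andP[/eqP zd /eqP zt]] tp] lp.
apply: connect_trans (same _ _ (esym zd)) _.
apply: connect_trans (glinkl _ _ _) _; rewrite eE.
by apply: IH; rewrite zt.
Qed.

Lemma org_onto (d0 : dart D) (v : vertex D) : exists d : dart D, org d = v.
Proof.
have /connectP[[|t p]] := diag_connected v (org d0); first by exists d0.
by move=> /= /andP[/existsP[z /andP[/eqP zd _]] _] _; exists z.
Qed.

(** The extra cycle of [n] is the outer region. A dart is required since the one-vertex diagram has
    no cycles at all. *)
Lemma diagram_ncyc (d0 : dart D) :
  [/\ ncyc e = #|dart D|./2, ncyc n = #|face D|.+1 & ncyc (e * n) = #|vertex D|].
Proof.
split.
- rewrite -(doubleK (ncyc e)) ncyc_invol //; first by move=> d; rewrite !eE einvK.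
  by move=> d; rewrite eE einv_neq.
- rewrite -card_option; apply: (ncyc_classes (g := @side _ D)).
    move=> x y; rewrite side_orbit; rewrite (eq_fconnect (f' := n)) //.
  move=> [f|]; first exact: side_onto.
  exact: side_outer.
- apply: (ncyc_classes (g := @org _ D)); last exact: org_onto.
  move=> x y; rewrite org_orbit (eq_fconnect (f' := (e * n)%g)) // => z.
  by rewrite permM eE nE.
Qed.

Lemma diagram_even (d0 : dart D) : #|dart D| = (#|dart D|./2).*2.
Proof.
have [<- _ _] := diagram_ncyc d0; rewrite ncyc_invol //; first by move=> d;
  rewrite !eE einvK.
by move=> d; rewrite eE einv_neq.
Qed.

Lemma no_dart (D0 : dart D -> False) : #|dart D| = 0 /\ #|face D| = 0.
Proof.
have zero (T : finType) : (T -> False) -> #|T| = 0.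
  by move=> T0; apply: eq_card0 => x; case: (T0 x).
split; apply: zero => // f; have [d _] := side_onto f; exact: D0.
Qed.

Lemma disk_of_diagram P W : diagram_over P D -> boundary_label D W ->
  exists ws, [/\ disk W ws, forall r, r \in ws -> relator_label P r,
    size ws = #|face D| & size W + size (flatten ws) = #|dart D|].
Proof.
move=> [_ facesP] [p [Up pcyc pE] Wp].
(* Without darts the diagram is a single vertex, which is the first alternative of [disk]. *)
have [d0 _|D0] := pickP (mem (dart D)); last first.
  have D0' : dart D -> False by move=> d; have := D0 d.
  have [-> ->] := no_dart D0'.
  have p0 : p = [::] by case: p {Up pcyc pE Wp} => // d; case: (D0' d).
  have W0 : W = [::] by apply: size0nil; rewrite -(size_cyclic_perm Wp) p0.
  by exists [::]; rewrite W0; split=> //; left.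
have [fd fdE] := fin_all_exists (@side_onto _ D).
pose F f := orbit (@Defs.next _ D) (fd f).
have FE f d : (d \in F f) = (side d == Some f).
  rewrite -fconnect_orbit -fdE; apply/idP/eqP; last by move/esym/side_orbit.
  by move/side_orbit.
pose cs := map F (enum (face D)).
have cov d : d \in flatten (p :: cs).
  rewrite /= mem_cat pE; case sd : (side d) => [f|] //=.
  by apply/flatten_mapP; exists f; rewrite ?mem_enum // FE sd.
have U : uniq (flatten (p :: cs)).
  rewrite /= cat_uniq Up /=; apply/andP; split.
    apply/hasPn => d /flatten_mapP[f _]; rewrite FE => /eqP sd.
    by rewrite /= pE sd.
  apply: uniq_flatten_map; [exact: enum_uniq|by move=> f; exact: orbit_uniq|].
  by move=> f g d; rewrite !FE => /eqP -> /eqP [].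
have facesF f : F f <> [::] by rewrite /F /orbit -orderSpred.
have pn : p != [::].
  have [d dE] := side_outer d0; apply/eqP => p0.
  by have := pE d; rewrite p0 dE.
have cyc : all (fcycle n) (p :: cs).
  have eqn : frel n =2 frel (@Defs.next _ D) by move=> x y; rewrite /= nE.
  rewrite /= (eq_cycle eqn) pcyc; apply/allP => _ /mapP[f _ ->].
  by rewrite (eq_cycle eqn); apply: cycle_orbit; exact: next_inj.
have P0 : plane_map (@lab _ D) e n (p :: cs).
  split=> //.
  - by move=> d; rewrite !eE einvK.
  - by move=> d; rewrite eE einv_neq.
  - by move=> d; rewrite eE lab_einv.
  rewrite /planar (gcard_connected d0 diagram_connected).
  have [-> -> ->] := diagram_ncyc d0; have := diag_euler D; have := diagram_even d0.
  by set h := _./2; clearbody h; clear; lia.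
exists (map (map (@lab _ D)) cs); split.
- apply: disk_cyclic (cyclic_perm_sym Wp) _.
  right; do 6!eexists; split; [exact: P0|exact: diagram_connected| |by []|by []].
  rewrite in_cons eq_sym (negbTE pn); apply/mapP => -[f _ /esym]; exact: facesF.
- move=> r /mapP[_ /mapP[f _ ->] ->]; exact: facesP (fdE f).
- by rewrite size_map /cs size_map -cardE.
- rewrite (size_cover U cov) /= size_cat -(size_cyclic_perm Wp) size_map.
  by congr (_ + _); rewrite -map_flatten size_map.
Qed.

End FromDiagram.

(** * From connected plane maps to diagrams *)

Section ToDiagram.

(** The set of cycles of [s], each represented by its root; it supplies the vertices and the regions
    of a diagram. *)
Definition cyc_class (T : finType) (s : {perm T}) : finType := {x : T | froots s x}.

Lemma cyc_proj_subproof (T : finType) (s : {perm T}) x : froots s (froot s x).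
Proof. by apply: roots_root; apply: fconnect_sym; exact: perm_inj. Qed.

Definition cyc_proj (T : finType) (s : {perm T}) x : cyc_class s :=
  Sub (froot s x) (cyc_proj_subproof s x).

Lemma cyc_proj_eq (T : finType) (s : {perm T}) x y :
  cyc_proj s x = cyc_proj s y <-> fconnect s x y.
Proof.
have ss := fconnect_sym (@perm_inj _ s); split=> [/(congr1 val)|] /=.
  by move/(rootP ss).
by move=> xy; apply: val_inj; exact/(rootP ss).
Qed.

Lemma card_cyc_class (T : finType) (s : {perm T}) : #|cyc_class s| = ncyc s.
Proof. by rewrite card_sig; apply: eq_card => x; rewrite !inE andbT. Qed.

Variables (T : finType) (lb : T -> letter L) (e n : {perm T}).
Variables (c : seq T) (cs : seq (seq T)).
Hypotheses (PM : plane_map lb e n (c :: cs)) (con : connected_map e n).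
Hypothesis nil : [::] \notin c :: cs.

Lemma diagram_of_map : exists D : diagram L,
  [/\ forall P, (forall d, (lb d).1 \in alphabet P) ->
       (forall d, d \in cs -> relator_label P (map lb d)) -> diagram_over P D,
     boundary_label D (map lb c), #|face D| = size cs & #|dart D| = #|T|].
Proof.
have cn : c != [::] by move: nil; rewrite in_cons negb_or eq_sym => /andP[].
have cov := plane_map_cover PM con cn.
have [x0 x0c] : exists x0, x0 \in c by case: (c) cn => // x0 c' _; exists x0;
  rewrite mem_head.
case: (PM) => eK efp labe pl U /andP[cycc cyccs] _.
pose out := cyc_proj n x0.
(* The 2-cells are the cycles of [n] other than the outer one, so [insub] returns [None] exactly on
   the darts of [c]. *)
pose F : finType := {f : cyc_class n | f != out}.
pose sd x : option F := insub (cyc_proj n x).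
have sdN x : (sd x == None) = (x \in c).
  rewrite -(fconnect_cycle cycc x0c) /sd; case: insubP => [u + uE|].
    move=> nout; apply/esym/negbTE; apply: contra nout => h; rewrite eq_sym;
      apply/eqP; exact/cyc_proj_eq.
  by rewrite negbK => /eqP /esym /cyc_proj_eq ->.
have nn : ncyc n = (size cs).+1.
  by rewrite (ncyc_cycles U _ nil cov) //= cycc.
have cF : #|F| = size cs.
  by rewrite card_sig (cardC1 out) card_cyc_class nn.
have sdE x y : sd x = sd y <-> fconnect n x y.
  split=> [|/cyc_proj_eq]; last by rewrite /sd => ->.
  move=> sxy; have [xc|xc] := boolP (x \in c).
    have yc : y \in c by rewrite -sdN -sxy sdN.
    by rewrite (fconnect_cycle cycc).
  move: sxy; rewrite /sd; case: insubP => [u _ uE|]; last first.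
    by rewrite -sdN /sd in xc; move=> h; rewrite insubN in xc.
  case: insubP => [v _ vE [uv]|] //.
  by apply/cyc_proj_eq; rewrite -uE -vE uv.
have enE x : (e * n)%g x = (n \o e) x by rewrite permM.
have orgE x y : cyc_proj (e * n)%g x = cyc_proj (e * n)%g y <-> fconnect (n \o e)
  x y.
  by rewrite cyc_proj_eq (eq_fconnect enE).
have sd_onto f : exists d, sd d = Some f.
  case: f => g gP; exists (val g).
  have gE : cyc_proj n (val g) = g by apply: val_inj; apply/eqP; exact: (valP g).
  by rewrite /sd gE (insubT (fun f => f != out) gP).
have sd_out : T -> exists d, sd d = None by exists x0; apply/eqP; rewrite sdN.
pose adj (s t : cyc_class (e * n)%g) :=
  [exists d, (cyc_proj (e * n)%g d == s) && (cyc_proj (e * n)%g (e d) == t)].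
have conn_v (u v : cyc_class (e * n)%g) : connect adj u v.
  have uE : u = cyc_proj (e * n)%g (val u) by apply/esym/val_inj/eqP;
    exact: (valP u).
  have vE : v = cyc_proj (e * n)%g (val v) by apply/esym/val_inj/eqP;
    exact: (valP v).
  rewrite uE vE; have /connectP[p + ->] := con (val u) (val v).
  elim: p (val u) => [|z p IH] x /=; first by rewrite connect0.
  case/andP=> /orP[] /eqP <- /IH; apply: connect_trans; apply: connect1.
    by apply/existsP; exists x; rewrite !eqxx.
  apply/existsP; exists x; rewrite eqxx /=; apply/eqP/cyc_proj_eq.
  by have := fconnect1 (e * n)%g (e x); rewrite permM eK.
have euler : #|cyc_class (e * n)%g| + #|F| = #|T|./2 + 1.
  have := pl; rewrite /planar (gcard_connected x0 con) card_cyc_class cF.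
  rewrite nn -(ncyc_invol eK efp) doubleK.
  by clear; lia.
pose D := @Diagram L (cyc_class (e * n)%g) T F (cyc_proj (e * n)%g) e n sd lb
  eK efp (@perm_inj _ n) orgE sdE sd_onto sd_out labe conn_v euler.
exists D; split=> //.
  move=> P lA csP; split=> // d f sdf.
  have dc : d \notin c by rewrite -sdN [sd d]sdf.
  have /flattenP[c' c'cs dc'] : d \in flatten cs by have := cov d;
    rewrite mem_cat (negbTE dc).
  have Uc' : uniq c'.
    move: U; rewrite /= cat_uniq => /and3P[_ _]; elim: (cs) c'cs => //= a s IH.
    by rewrite in_cons cat_uniq => /orP[/eqP ->|h] /and3P[Ua _ Us] //; exact: IH.
  have [s Ps rs] := csP _ c'cs.
  have cyc' : cyclic_perm (map lb (orbit n d)) (map lb c').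
    have [i ->] := orbit_rot_cycle (allP cyccs _ c'cs) Uc' dc'.
    by exists i; rewrite map_rot.
  by exists s => //; case: rs => /(cyclic_perm_trans cyc'); [left|right].
exists c; last exact: cyclic_permxx.
split=> //.
have /and3P[] // : [&& uniq c, ~~ has (mem c) (flatten cs) & uniq (flatten cs)].
by rewrite -cat_uniq.
Qed.

End ToDiagram.

Lemma trivial_diagram : exists D : diagram L,
  [/\ forall P, diagram_over P D, boundary_label D [::],
    #|face D| = 0 & #|dart D| = 0].
Proof.
pose F (A : Type) (v : void) : A := match v with end.
have euler : #|{: unit}| + #|{: void}| = #|{: void}|./2 + 1.
  by rewrite card_unit card_void.
pose D := @Diagram L unit void void (F _) (F _) (F _) (F _) (F _)
  (fun d => F _ d) (fun d => F _ d) (fun d => F _ d) (fun d => F _ d) (fun d =>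
    F _ d)
  (fun f => F _ f) (fun d => F _ d) (fun d => F _ d)
  (fun s t : unit => match s, t with tt, tt => connect0 _ _ end) euler.
exists D; split=> //; try exact: card_void.
by exists [::]; [split=> // d; case: d|exact: cyclic_permxx].
Qed.

Lemma diagram_of_disk P W ws : word_over (alphabet P) W -> disk W ws ->
  (forall r, r \in ws -> relator_label P r) ->
  exists D : diagram L, [/\ diagram_over P D, boundary_label D W,
    #|face D| = size ws & #|dart D| = size W + size (flatten ws)].
Proof.
move=> oW [[-> ->] _|[T [lb [e [n [c [cs [PM con nil WE ->]]]]]]] rel].
  by have [D [? ? ? ?]] := trivial_diagram; exists D.
have [D [ov bl cf cd]] := diagram_of_map PM con nil.
have cn : c != [::] by move: nil; rewrite in_cons negb_or eq_sym => /andP[].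
have cov := plane_map_cover PM con cn.
exists D; split=> //; first 1 last.
- by rewrite WE.
- by rewrite size_map.
- rewrite cd (size_cover (pm_uniq PM) cov) WE /= size_cat size_map; congr (_ + _).
  by rewrite -map_flatten size_map.
have rel' d : d \in cs -> relator_label P (map lb d) by move=> dcs; apply: rel;
  exact: map_f.
apply: (ov P _ rel') => d; have := cov d;
  rewrite mem_cat => /orP[dc|/flattenP[c' c'cs dc']].
  by move: oW; rewrite WE /word_over all_map => /allP /(_ _ dc).
by have := relator_label_over (rel' _ c'cs);
  rewrite /word_over all_map => /allP /(_ _ dc').
Qed.

End Diagrams.

(** * Dehn functions *)

Section MinMax.
Implicit Type A : set nat.

Lemma nat_minP A n0 : A n0 -> A (nat_min A) /\ forall m, A m -> nat_min A <= m.
Proof.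
move=> An; apply: (@xgetPex _ 0 [set n | A n /\ forall m, A m -> n <= m]%classic).
have ex : exists n, `[< A n >] by exists n0; exact/asboolP.
exists (ex_minn ex); case: ex_minnP => m /asboolP Am min; split=> // k Ak.
by apply: min; exact/asboolP.
Qed.

Lemma nat_max_mem A : nat_max A = 0 \/ A (nat_max A).
Proof. by rewrite /nat_max; case: xgetP => [n _ []|_]; [right|left]. Qed.

(** The bound [N] makes the maximum exist, so [nat_max] does not fall back on its default value. *)
Lemma nat_max_ge A N m : (forall n, A n -> n <= N) -> A m -> m <= nat_max A.
Proof.
move=> AN Am.
have [_ + ] : A (nat_max A) /\ forall k, A k -> k <= nat_max A; last exact.
apply: (@xgetPex _ 0 [set n | A n /\ forall k, A k -> k <= n]%classic).
have ex : exists n, `[< A n >] by exists m; exact/asboolP.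
have bd i : `[< A i >] -> i <= N by move=> /asboolP; exact: AN.
exists (ex_maxn ex bd); case: ex_maxnP => k /asboolP Ak max; split=> // i Ai.
by apply: max; exact/asboolP.
Qed.

End MinMax.

Section DehnFunctions.
Variable L : choiceType.
Implicit Types (u v w W : word L) (ws rs : seq (word L)) (P : presentation L).
Implicit Types (D : diagram L) (j : nat).

Lemma ncl_over P w : normal_closure P w -> word_over (alphabet P) w.
Proof.
elim=> {w} [|r /relatorsP[]|u v _ ou _ ov|u _ ou|g u og _ ou|u v ov _ _ _] //.
- by rewrite word_over_cat ou.
- by rewrite word_over_winv.
- by rewrite !word_over_cat word_over_winv og ou.
Qed.

Lemma relator_label1 P r : relators P r -> relator_label P r.
Proof. by move=> Pr; exists r => //; left; exact: cyclic_permxx. Qed.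

Lemma ncl_cprod P w : normal_closure P w ->
  exists2 rs, cprod rs w & forall r, r \in rs -> relator_label P r.
Proof.
elim=> {w} [|r Pr|u v _ [rs cu ru] _ [rs' cv rv]|u _ [rs cu ru]|g u _ _ [rs cu ru]|
            u v _ uv _ [rs cu ru]].
- by exists [::] => //; exact: cprod_nil.
- exists [:: r]; first exact: cprod1.
  by move=> s; rewrite inE => /eqP ->; exact: relator_label1.
- exists (rs ++ rs'); first exact: cprod_cat.
  by move=> r; rewrite mem_cat => /orP[/ru|/rv].
- exists (map (@winv L) rs); first exact: cprod_winv.
  by move=> _ /mapP[r /ru rr ->]; exact: relator_label_winv.
- by exists rs => //; exact: cprod_conj.
- by exists rs => //; exact: cprod_eq cu.
Qed.

Lemma diagram_of_cprod P rs W : word_over (alphabet P) W -> cprod rs W ->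
  (forall r, r \in rs -> relator_label P r) ->
  exists D, [/\ diagram_over P D, boundary_label D W,
    #|face D| <= size rs & #|dart D| <= size W + size (flatten rs)].
Proof.
move=> oW /disk_of_cprod[ws [dW sub s1 s2]] rel.
have relw r : r \in ws -> relator_label P r.
  by move=> /sub /mapP[s /rel rs' ->]; exact: relator_label_winv.
have [D [oD bD cf cd]] := diagram_of_disk oW dW relw.
by exists D; rewrite cf cd leq_add2l.
Qed.

Lemma size_flatten_winv rs : size (flatten (map (@winv L) rs)) = size (flatten rs).
Proof. by elim: rs => //= r rs IH; rewrite !size_cat size_winv IH. Qed.

Lemma cprod_of_diagram P D W : diagram_over P D -> boundary_label D W ->
  exists rs, [/\ cprod rs W, forall r, r \in rs -> relator_label P r,
    size rs = #|face D| & size W + size (flatten rs) = #|dart D|].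
Proof.
move=> oD bD; have [ws [dW rel <- <-]] := disk_of_diagram oD bD.
have [rs prs /cprod_winv] := cprod_of_disk dW; rewrite winvK => crs.
exists (map (@winv L) rs); split=> //.
- by move=> _ /mapP[r + ->]; rewrite (perm_mem prs) => /rel;
  exact: relator_label_winv.
- by rewrite size_map (perm_size prs).
- by rewrite size_flatten_winv (perm_size (perm_flatten prs)).
Qed.

Lemma diagram_cells D : #|dart D| = (#|dart D|./2).*2 /\
  #|vertex D| <= (#|dart D|./2).+1.
Proof.
split; last by have := diag_euler D; rewrite addn1 => <-; rewrite leq_addr.
have [d0 _|D0] := pickP (mem (dart D)); first exact: diagram_even.
by have [|-> _] := @no_dart _ D; first by move=> d; have := D0 d.
Qed.

Lemma min_cellsP j P W : normal_closure P W ->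
  exists D, [/\ diagram_over P D,
    boundary_label D W & num_cells j D = min_cells j P W].
Proof.
move=> nW; have [rs crs rel] := ncl_cprod nW.
have [D [oD bD _ _]] := diagram_of_cprod (ncl_over nW) crs rel.
by case: (@nat_minP [set n | exists D : diagram L,
    [/\ diagram_over P D, boundary_label D W &
      num_cells j D = n]]%classic (num_cells j D)) => //; exists D.
Qed.

Lemma min_cells_le j P W D : diagram_over P D -> boundary_label D W ->
  min_cells j P W <= num_cells j D.
Proof.
move=> oD bD; rewrite /min_cells; set A := (X in nat_min X).
have AD : A (num_cells j D) by exists D.
by have [_] := nat_minP AD; apply.
Qed.

(** There are finitely many words of bounded length over a finite alphabet; hence the maximum
    defining a Dehn function is attained. *)
Lemma bounded_words (A : {fset L}) x (F : word L -> nat) :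
  exists N, forall W, word_over A W -> size W <= x -> F W <= N.
Proof.
elim: x F => [|x IH] F.
  by exists (F [::]) => W _; rewrite leqn0 size_eq0 => /eqP ->.
pose letters : seq (letter L) := [seq (a, s) | a <- (A : seq L), s <- [:: true;
  false]].
have [N NP] : exists N, forall a, a \in letters ->
    forall W, word_over A W -> size W <= x -> F (a :: W) <= N.
  elim: letters => [|a s [N NP]]; first by exists 0.
  have [M MP] := IH (fun W => F (a :: W)); exists (maxn M N) => b.
  rewrite in_cons => /orP[/eqP ->|bs] W oW sW; rewrite leq_max.
    by rewrite MP.
  by rewrite (NP b bs) ?orbT.
exists (maxn (F [::]) N) => -[|[a s] W] oW sW; rewrite leq_max ?leqnn //.
move: oW => /= /andP[aA oW]; rewrite NP ?orbT //.
by apply/allpairsP; exists (a, s); split=> //; case: (s).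
Qed.

Lemma dehn_ge j P x W : normal_closure P W -> size W <= x ->
  min_cells j P W <= dehn j P x.
Proof.
move=> nW sW; have [N NP] := bounded_words (alphabet P) x (min_cells j P).
apply: (@nat_max_ge _ N); last by exists W.
by move=> n [V [nV sV <-]]; apply: NP => //; exact: ncl_over.
Qed.

(** Comparison word by word. The word [V] may differ from [W], as is needed when a letter is
    erased. *)
Lemma preceq_dehn i j P P' c :
  (forall W, normal_closure P' W ->
    exists V, [/\ normal_closure P V, size V <= size W &
     min_cells i P' W <= c * min_cells j P V + c * size W + c]) ->
  preceq (dehn i P') (dehn j P).
Proof.
(* The linear term uses [c] twice, the second time to absorb the additive constant, as [x] is at
   least 1; the 1 makes the constant positive. *)
move=> H; exists (2 * c + 1); first by rewrite addn1.
move=> x x0; case: (nat_max_mem [set n | exists W : word L,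
  [/\ normal_closure P' W, size W <= x & min_cells i P' W = n]]%classic).
  by move=> d0; rewrite /dehn d0.
rewrite -/(dehn i P' x) => -[W [nW sW <-]].
have [V [nV sV le]] := H W nW.
have gV : min_cells j P V <= dehn j P ((2 * c + 1) * x).
  by apply: dehn_ge => //; rewrite (leq_trans sV) // (leq_trans sW) // leq_pmull
    // addn1.
apply: leq_trans le _.
have h1 : c * min_cells j P V <= (2 * c + 1) * dehn j P ((2 * c + 1) * x).
  by apply: leq_mul => //; lia.
have h2 : c * size W <= c * x by rewrite leq_mul2l sW orbT.
have h3 : c <= c * x by rewrite leq_pmulr.
by rewrite -addnA; apply: leq_add h1 _; move: h2 h3; clear; lia.
Qed.

End DehnFunctions.

(** * Transformations of presentations *)

Section Presentations.
Variable L : choiceType.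
Implicit Types (u v w W : word L) (ws rs : seq (word L)) (P : presentation L).
Implicit Types (D : diagram L).

Lemma size_flatten_map k (F : word L -> seq (word L)) rs :
  (forall r, r \in rs -> size (F r) <= k /\ size (flatten (F r)) <= k * size r) ->
  size (flatten (map F rs)) <= k * size rs /\
  size (flatten (flatten (map F rs))) <= k * size (flatten rs).
Proof.
elim: rs => [|r rs IH] H /=; first by rewrite !muln0.
have [h1 h2] := H r (mem_head _ _).
have [|h3 h4] := IH; first by move=> s srs; apply: H; rewrite in_cons srs orbT.
by rewrite flatten_cat !size_cat mulnS mulnDr !leq_add.
Qed.

Lemma finite_relators_cprod P' (s : seq (word L)) :
  (forall r, r \in s -> normal_closure P' r) ->
  exists k, forall r, r \in s -> exists rs,
    [/\ cprod rs r, forall t, t \in rs -> relator_label P' t,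
        size rs <= k & size (flatten rs) <= k].
Proof.
elim: s => [|r s IH] ns; first by exists 0.
have [|k kP] := IH; first by move=> t ts; apply: ns; rewrite in_cons ts orbT.
have [rs crs rel] := ncl_cprod (ns r (mem_head _ _)).
exists (maxn k (maxn (size rs) (size (flatten rs)))) => t.
rewrite in_cons => /orP[/eqP ->|/kP [rs' [c' rel' s1 s2]]]; [exists rs|exists rs'];
  by split=> //; rewrite !leq_max ?leqnn ?s1 ?s2 ?orbT.
Qed.

(** One constant serves a possibly infinite set of relators: those outside the finite set [S] stand
    for themselves. *)
Lemma relator_substitution P P' (S : set (word L)) :
  finite_set S -> (forall r, relators P r -> relators P' r \/ S r) ->
  (forall r, S r -> normal_closure P' r) ->
  exists2 k, 0 < k & forall r, relator_label P r -> exists rs,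
    [/\ cprod rs r, forall t, t \in rs -> relator_label P' t,
        size rs <= k & size (flatten rs) <= k * size r].
Proof.
move=> /finite_seqP[s SE] PP' nS.
have [|k kP] := @finite_relators_cprod P' s.
  by move=> r rs; apply: nS; rewrite SE /=.
(* The successor leaves room for the single factor of an unchanged relator. Total length at most [k]
   becomes a multiple of the positive length of [r]. *)
exists k.+1 => // r rP; have r0 := relator_label_neq0 rP.
have rpos : 0 < size r by case: (r) r0.
case: rP => t Pt rt; case: (PP' t Pt) => [P't|].
  exists [:: r]; split=> //; first exact: cprod1.
    by move=> _ /[!inE] /eqP ->; exists t.
  by rewrite /= cats0 leq_pmull.
rewrite SE => /kP [rs [crs rel s1 s2]].
have s3 : size (flatten rs) <= k.+1 * size r.
  by rewrite (leq_trans s2) // (leq_trans (leqnSn k)) // leq_pmulr.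
case: rt => rt.
  by exists rs; split=> //; [exact: cprod_cyclic crs|exact: leqW].
exists (map (@winv L) rs); split.
- exact: cprod_cyclic (cprod_winv crs).
- by move=> _ /mapP[q /rel qr ->]; exact: relator_label_winv.
- by rewrite size_map leqW.
- by rewrite size_flatten_winv.
Qed.

Lemma diagram_substitution P P' (S : set (word L)) : alphabet P' = alphabet P ->
  finite_set S -> (forall r, relators P r -> relators P' r \/ S r) ->
  (forall r, S r -> normal_closure P' r) ->
  exists k, forall W D, normal_closure P W -> diagram_over P D ->
    boundary_label D W ->
    exists D', [/\ diagram_over P' D', boundary_label D' W,
      #|face D'| <= k * #|face D| & #|dart D'| <= k * #|dart D|].
Proof.
move=> AA fS PP' nS; have [k k0 kP] := relator_substitution fS PP' nS.
have /choice[F FP] : forall r, exists rs, relator_label P r ->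
    [/\ cprod rs r, forall t, t \in rs -> relator_label P' t,
        size rs <= k & size (flatten rs) <= k * size r].
  by move=> r; have [/kP [rs ?]|?] := pselect (relator_label P r);
    [exists rs|exists [::]].
exists k => W D nW oD bD; have [rs [crs rel <- <-]] := cprod_of_diagram oD bD.
have [|s1 s2] := @size_flatten_map k F rs; first by move=> r /rel /FP[].
have oW : word_over (alphabet P') W by rewrite AA; exact: ncl_over nW.
have [||D' [oD' bD' cf cd]] := @diagram_of_cprod _ _ (flatten (map F rs)) _ oW.
- by apply: cprod_flatten crs => r /rel /FP[].
- by move=> t /flatten_mapP[r /rel /FP[_ h _ _] tF]; exact: h tF.
exists D'; split=> //; first exact: leq_trans cf s1.
(* Since [k] is positive, the boundary length in the count of darts is covered as well. *)
by rewrite (leq_trans cd) // mulnDr leq_add // leq_pmull.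
Qed.

Lemma preceq_substitution P P' (S : set (word L)) : alphabet P' = alphabet P ->
  finite_set S -> (forall r, relators P r -> relators P' r \/ S r) ->
  (forall r, S r -> normal_closure P' r) ->
  (forall w, normal_closure P' w <-> normal_closure P w) ->
  [/\ preceq (dehn 0 P') (dehn 1 P), preceq (dehn 1 P') (dehn 1 P) &
      preceq (dehn 2 P') (dehn 2 P)].
Proof.
move=> AA fS PP' nS nn; have [k kP] := diagram_substitution AA fS PP' nS.
have half D D' : #|dart D'| <= k * #|dart D| -> #|dart D'|./2 <= k * #|dart D|./2.
  have [-> _] := diagram_cells D; have [-> _] := diagram_cells D'.
  by rewrite !doubleK -doubleMr leq_double.
(* The additive constant absorbs the 1 in the bound $V \le E + 1$. *)
split; apply: (@preceq_dehn _ _ _ _ _ k.+1) => W /nn nW; exists W; split=> //.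
- have [D [oD bD <-]] := min_cellsP 1 nW;
  have [D' [oD' bD' _ /half cd]] := kP W D nW oD bD.
  have [_ cv] := diagram_cells D'.
  have := min_cells_le 0 oD' bD'; rewrite /num_cells; move: cv cd.
  set a := _./2; set b := _./2; clearbody a b; clear; lia.
- have [D [oD bD <-]] := min_cellsP 1 nW;
  have [D' [oD' bD' _ /half cd]] := kP W D nW oD bD.
  have := min_cells_le 1 oD' bD'; rewrite /num_cells; move: cd.
  set a := _./2; set b := _./2; clearbody a b; clear; lia.
- have [D [oD bD <-]] := min_cellsP 2 nW;
  have [D' [oD' bD' cf _]] := kP W D nW oD bD.
  by have := min_cells_le 2 oD' bD'; rewrite /num_cells; move: cf; clear; lia.
Qed.

Lemma T_transformation_dehn P P' : T_transformation P P' ->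
  [/\ preceq (dehn 0 P') (dehn 1 P), simeq (dehn 1 P') (dehn 1 P) &
      simeq (dehn 2 P') (dehn 2 P)].
Proof.
move=> [S [U [[fS SR fU UA] [AA RE nn]]]].
have [||h0 h1 h2] := preceq_substitution AA fS _ _ nn.
- move=> r Pr; rewrite RE; have [Sr|nSr] := pselect (S r); first by right.
  by left; left.
- by move=> r /SR Pr; apply/nn; exact: ncl_relator.
(* Conversely, each new relator is an old one or lies in the finite set [U]. *)
have [|||_ h1' h2'] := preceq_substitution (esym AA) fU.
- by move=> r; rewrite RE => -[[Pr _]|Ur]; [left|right].
- by move=> r Ur; apply/nn; apply: ncl_relator; rewrite RE; right.
- by move=> w; split=> /nn.
by split.
Qed.

(** * Stabilizations *)

Section AddLetter.
Variables (P P' : presentation L) (b : L).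
Hypotheses (bA : b \notin alphabet P) (AE : alphabet P' = (b |` alphabet P)%fset).
Hypothesis RE : relators P' = (relators P `|` [set [:: (b, true)]])%classic.

Definition erase w : word L := [seq x <- w | x.1 != b].

Lemma word_over_add w : word_over (alphabet P) w -> word_over (alphabet P') w.
Proof. by apply: sub_all => x xA; rewrite /= AE in_fset1U xA orbT. Qed.

Lemma erase_id w : word_over (alphabet P) w -> erase w = w.
Proof.
by move=> ow; apply/all_filterP; apply: sub_all ow => x; apply: contraTneq => ->.
Qed.

Lemma word_over_erase w : word_over (alphabet P') w ->
  word_over (alphabet P) (erase w).
Proof.
move=> ow; apply/allP => x; rewrite mem_filter => /andP[xb xw].
by have := allP ow x xw; rewrite AE in_fset1U (negbTE xb).
Qed.

Lemma erase_winv w : erase (winv w) = winv (erase w).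
Proof. by rewrite /erase /winv filter_rev filter_map. Qed.

Lemma erase_cat u v : erase (u ++ v) = erase u ++ erase v.
Proof. exact: filter_cat. Qed.

Lemma free_eq_erase u v : free_eq u v -> free_eq (erase u) (erase v).
Proof.
elim=> {u v} [w|u v _|u v w _ + _|u x v].
- exact: free_eq_refl.
- exact: free_eq_sym.
- exact: free_eq_trans.
rewrite !erase_cat /=; case: (x.1 != b); last exact: free_eq_refl.
exact: free_eq_cancel.
Qed.

Lemma ncl_add w : normal_closure P w -> normal_closure P' w.
Proof.
elim=> {w} [|r Pr|u v _ nu _ nv|u _ nu|g u og _ nu|u v ov uv _ nu].
- exact: ncl_one.
- by apply: ncl_relator; rewrite RE; left.
- exact: ncl_mul.
- exact: ncl_inv.
- by apply: ncl_conj => //; exact: word_over_add.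
- by apply: ncl_free_eq uv nu; exact: word_over_add.
Qed.

Lemma ncl_erase w : normal_closure P' w -> normal_closure P (erase w).
Proof.
elim=> {w} [|r|u v _ nu _ nv|u _ nu|g u og _ nu|u v ov uv _ nu].
- exact: ncl_one.
- rewrite RE => -[Pr|->]; last by rewrite /erase /= eqxx; exact: ncl_one.
  by case: (relatorsP Pr) => _ /erase_id -> _; exact: ncl_relator.
- by rewrite erase_cat; exact: ncl_mul.
- by rewrite erase_winv; exact: ncl_inv.
- by rewrite !erase_cat erase_winv; apply: ncl_conj => //; exact: word_over_erase.
- by apply: ncl_free_eq nu; [exact: word_over_erase|exact: free_eq_erase].
Qed.

(* Both sides of an edge labelled b would be 2-cells with boundary b^{+-1},
   making the whole diagram a sphere without outer region. *)
Lemma diagram_restrict D W : word_over (alphabet P) W ->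
  diagram_over P' D -> boundary_label D W -> diagram_over P D.
Proof.
move=> oW [labA facesP] [p [Up pcyc pE] pW].
have outer (d : dart D) : side d = None -> (lab d).1 \in alphabet P.
  move=> sd; have dp : d \in p by rewrite pE sd.
  have : word_over (alphabet P) (map (@lab L D) p) by rewrite (word_over_cyclic _
    pW).
  by rewrite /word_over all_map => /allP /(_ _ dp).
have inner (d : dart D) f : side d = Some f ->
  (lab d).1 \in alphabet P \/ Defs.next d = d.
  move=> /facesP[r]; rewrite RE => -[Pr rd|-> rd].
    left; have rl : relator_label P (map (@lab L D) (orbit (@Defs.next L D) d))
      by exists r.
    have := relator_label_over rl; rewrite /word_over all_map => /allP; apply.
    exact: in_orbit.
  right; have : size (map (@lab L D) (orbit (@Defs.next L D) d)) = 1.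
    by case: rd => /size_cyclic_perm ->.
  rewrite size_map size_orbit => o1.
  by have := iter_order (@next_inj L D) d; rewrite o1.
have labP (d : dart D) : (lab d).1 \in alphabet P.
  case sd : (side d) => [f|]; last exact: outer.
  case: (inner d f sd) => // nd.
  have -> : (lab d).1 = (lab (einv d)).1 by rewrite lab_einv.
  case sd' : (side (einv d)) => [f'|]; last exact: outer.
  case: (inner _ f' sd') => // nd'.
  have [d1 sd1] := side_outer d.
  have : d1 \in [:: d; einv d].
    have cl : closed (glink (perm (can_inj (@einvK _ D))) (perm (@next_inj _ D)))
      (mem [:: d; einv d]).
      apply: intro_closed; first exact: glink_sym.
      move=> x y /orP[] /eqP <-; rewrite permE !inE => /orP[]/eqP ->.
      - by rewrite eqxx orbT.
      - by rewrite einvK eqxx.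
      - by rewrite nd eqxx.
      - by rewrite nd' eqxx orbT.
    by have := closed_connect cl (diagram_connected d d1); rewrite !inE eqxx => <-.
  by rewrite !inE => /orP[]/eqP dE; move: sd1; rewrite dE ?sd ?sd'.
split=> // d f sdf; have [r + rd] := facesP d f sdf; rewrite RE => -[Pr|rE];
  first by exists r.
have din : lab d \in map (@lab L D) (orbit (@Defs.next L D) d).
  by apply: map_f; exact: in_orbit.
have db : (lab d).1 = b.
  by case: rd din => -[i ->]; rewrite mem_rot rE inE => /eqP ->.
by have := labP d; rewrite db (negbTE bA).
Qed.

(** [u] is the part of the boundary already treated. Each erased letter returns as a loop around a
    2-cell of length one; the last equation counts one edge, that is two darts, per loop. *)
Lemma disk_insert u w ws : disk (u ++ erase w) ws -> exists ls,
  [/\ disk (u ++ w) (ws ++ ls), forall r, r \in ls -> relator_label P' r,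
     size ls <= size w & size w + size (flatten ls) = size (erase w) + (size
       ls).*2].
Proof.
elim: w u => [|x w IH] u; first by move=> d; exists [::]; rewrite (cats0 ws).
rewrite {1}/erase /=; have [xb|xb] := eqVneq x.1 b; rewrite /= -/(erase w);
  last first.
  rewrite -cat_rcons => /IH[ls [d1 rel s1 s2]]; exists ls; rewrite -cat_rcons.
  by split=> //=; [exact: leqW|rewrite !addSn s2].
move=> /IH[ls [d1 rel s1 s2]]; exists (ls ++ [:: [:: linv x]]); split.
- rewrite catA -cat_rcons -cats1; apply: disk_rot; rewrite catA; apply: disk_loop.
  exact: disk_rot.
- move=> r; rewrite mem_cat inE => /orP[/rel //|/eqP ->].
  exists [:: (b, true)]; first by rewrite RE; right.
  have [xE|xE] : x = (b, true) \/ x = (b, false).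
    by case: (x) xb => a [] /= ->; [left|right].
    by right; rewrite xE; exact: cyclic_permxx.
  by left; rewrite xE; exact: cyclic_permxx.
- by rewrite size_cat addn1.
- rewrite flatten_cat !size_cat /= !addn1 doubleS; move: s2; clear; lia.
Qed.

Lemma diagram_add_loops D W : word_over (alphabet P') W ->
  diagram_over P D -> boundary_label D (erase W) ->
  exists D', [/\ diagram_over P' D', boundary_label D' W &
    forall j, j <= 2 -> num_cells j D' <= num_cells j D + size W].
Proof.
move=> oW oD bD; have [ws [dW rel sF sD]] := disk_of_diagram oD bD.
have [ls [dW' rel' s1 s2]] := @disk_insert [::] W ws dW.
have [r|D' [oD' bD' cf cd]] := diagram_of_disk oW dW'.
  rewrite mem_cat => /orP[/rel|/rel' //] [s Ps sr].
  by exists s => //; rewrite RE; left.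
rewrite size_cat sF in cf; rewrite flatten_cat size_cat addnCA s2 addnCA addnA sD
  in cd.
have [ev _] := diagram_cells D; have [ev' _] := diagram_cells D'.
have ed : #|dart D'|./2 = #|dart D|./2 + size ls.
  by apply: double_inj; rewrite -ev' cd doubleD -ev.
(* Edges and 2-cells grow by the same number, so Euler's formula keeps the number of vertices. *)
have eV : #|vertex D'| = #|vertex D|.
  apply/eqP; rewrite -(eqn_add2r #|face D'|) diag_euler ed cf addnA diag_euler.
  by rewrite addnAC.
exists D'; split=> // -[|[|[|//]]] _ /=; first by rewrite eV leq_addr.
  by rewrite ed leq_add2l.
by rewrite cf leq_add2l.
Qed.

(** Over the larger alphabet, [b] is erased from [W] and restored by loops, at the cost of at most
    $|W|$ cells. Over the smaller one, a minimal diagram of [P'] is already a diagram of [P]. *)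
Lemma add_letter_dehn j : j <= 2 -> simeq (dehn j P') (dehn j P).
Proof.
move=> j2; split; apply: (@preceq_dehn _ _ _ _ _ 1) => W nW.
  exists (erase W); split; [exact: ncl_erase|by rewrite size_filter count_size|].
  have nE := ncl_erase nW; have [D [oD bD <-]] := min_cellsP j nE.
  have [D' [oD' bD' /(_ j j2) le]] := diagram_add_loops (ncl_over nW) oD bD.
  by have := min_cells_le j oD' bD'; move: le; clear; lia.
exists W; split=> //; first exact: ncl_add.
have [D [oD bD <-]] := min_cellsP j (ncl_add nW).
have oD' := diagram_restrict (ncl_over nW) oD bD.
by have := min_cells_le j oD' bD; clear; lia.
Qed.

End AddLetter.

(** Deletion is addition read backwards, and [simeq] is symmetric. *)
Lemma delete_letter_add P P' : delete_letter P P' -> add_letter P' P.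
Proof.
move=> [b [[bA Rb _] [AE RE]]]; exists b; split.
- by rewrite AE in_fsetD1 eqxx.
- by rewrite AE fsetD1K.
- rewrite RE; apply/seteqP; split=> [r Pr|r [[]|->]] //.
  by have [rb|rb] := pselect (r = [:: (b, true)]); [right|left].
Qed.

Lemma stabilization_dehn P P' j : stabilization P P' -> j <= 2 ->
  simeq (dehn j P') (dehn j P).
Proof.
move=> [[b [bA AE RE]]|/delete_letter_add [b [bA AE RE]]] j2.
  exact: (add_letter_dehn bA AE RE j2).
by have [] := add_letter_dehn bA AE RE j2.
Qed.

End Presentations.

Theorem theorem1p6 (L : choiceType) (P P' : presentation L) :
  (T_transformation P P' ->
     [/\ preceq (dehn 0 P') (dehn 1 P),
         simeq (dehn 1 P') (dehn 1 P) &
         simeq (dehn 2 P') (dehn 2 P)]) /\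
  (stabilization P P' ->
     forall j : nat, j <= 2 -> simeq (dehn j P') (dehn j P)).
Proof.
split; first exact: T_transformation_dehn.
by move=> st j; exact: stabilization_dehn.
Qed.
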